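(* Let $(\rho,\mathbf u,\phi)$ be a global classical solution, with radial symmetry, of the damped Euler--Monge--Amp\`ere system $$\partial_t\rho+\nabla\cdot(\rho\mathbf u)=0,\qquad \partial_t(\rho\mathbf u)+\nabla\cdot(\rho\mathbf u\otimes\mathbf u)=-\kappa\rho\nabla\phi-\beta\rho\mathbf u,\qquad \det(\mathbb I-D^2\phi)=\rho$$ on $\mathbb R^n$. Let $\varepsilon>0$ be arbitrary. Then the solution converges to the equilibrium state $(\rho,\mathbf u)=(1,\mathbf 0)$ at an exponential rate: for all $t\ge0$, $$\|\nabla\mathbf u(\cdot,t),\,\mathbf u(\cdot,t),\,\rho(\cdot,t)-1,\,\partial_r^2\phi(\cdot,t),\,\partial_r\phi(\cdot,t)\|_{L^\infty(\mathbb R^n)}\lesssim e^{-\gamma t},$$ where the decay constant $\gamma$ is as follows. • Strong damping ($\beta>2\sqrt\kappa$), with $\lambda_2=\frac{\beta+\sqrt{\beta^2-4\kappa}}2$: $\gamma=\frac{\beta+\sqrt{\beta^2-4\kappa}}{2}$ if $\frac{u_0'(r)+\lambda_2\phi_0''(r)}{1-\phi_0''(r)}=0$ for all $r>0$, and $\gamma=\frac{\beta-\sqrt{\beta^2-4\kappa}}2$ if $\frac{u_0'(r)+\lambda_2\phi_0''(r)}{1-\phi_0''(r)}\ne0$ (for some $r>0$). • Critical damping ($\beta=2\sqrt\kappa$), with $\alpha=\frac\beta2$: $\gamma=\frac\beta2$ if $\frac{u_0'(r)+\alpha\phi_0''(r)}{1-\phi_0''(r)}=0$ for all $r>0$, and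 $\gamma=\frac\beta2-\varepsilon$ if $\frac{u_0'(r)+\alpha\phi_0''(r)}{1-\phi_0''(r)}\ne0$ (for some $r>0$). • Weak damping ($\beta<2\sqrt\kappa$): $\gamma=\frac\beta2$.
   Context: Here $n\ge1$, $\kappa>0$, $\beta>0$; $\rho$ is the density, $\mathbf u$ the velocity, $\phi$ the potential normalized by $\phi(0)=0$. Solutions are radially symmetric without swirl: $\rho(\mathbf x,t)=\rho(r,t)$, $\mathbf u(\mathbf x,t)=\frac{\mathbf x}{r}u(r,t)$, $\phi(\mathbf x,t)=\phi(r,t)$, $r=|\mathbf x|$, with $\partial_r\rho(0,t)=0$, $u(0,t)=0$, $\partial_r\phi(0,t)=0$; $(\rho_0,u_0,\phi_0)$ denote the radial initial profiles, which are non-vacuous in the sense $\phi_0''(r)<1$. The norm of a list of functions is the maximum (or sum) of the norms of its entries. $A\lesssim B$ means $A\le CB$ for a positive constant $C$ (independent of $t$) depending at most on $\beta,\kappa$, the dimension $n$, the initial data and, in the critically damped regime, on $\varepsilon$.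
   Formalization: Three conditions are added, without which decay fails: the stated norm is finite at t=0; the velocity gradient is bounded on every finite time interval; and non-vacuity is uniform, φ0''(r) ≤ 1−c for some c>0, instead of pointwise φ0''(r)<1. *)

(* Defs.v *)
From HB Require Import structures.
From mathcomp Require Import all_boot all_order all_algebra.
From mathcomp Require Import all_classical all_reals all_analysis.
Set Implicit Arguments.
Unset Strict Implicit.
Unset Printing Implicit Defensive.
Import Order.TTheory GRing.Theory Num.Theory.
Import numFieldNormedType.Exports.
Local Open Scope classical_set_scope.
Local Open Scope ring_scope.

(* Points of R^n are row vectors.  The library norm `|x| on 'rV is the max
   norm, so the Euclidean length r = |x| is defined separately. *)
Definition enorm (R : realType) (d : nat) (x : 'rV[R]_d) : R :=
  Num.sqrt (\sum_i x 0 i ^+ 2).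

Definition grad (R : realType) (d : nat) (f : 'rV[R]_d -> R) (x : 'rV[R]_d) :
  'rV[R]_d := \row_i 'D_(delta_mx 0 i) f x.

(* ('J F x) i j is the i-th partial derivative of the j-th component of F. *)
Definition divergence (R : realType) (d : nat) (F : 'rV[R]_d -> 'rV[R]_d)
  (x : 'rV[R]_d) : R := \tr ('J F x).

Definition hessian (R : realType) (d : nat) (f : 'rV[R]_d -> R)
  (x : 'rV[R]_d) : 'M[R]_d := 'J (grad f) x.

(* The j-th component of the divergence of rho u (x) u. *)
Definition div_flux (R : realType) (d : nat) (rho : 'rV[R]_d -> R)
  (u : 'rV[R]_d -> 'rV[R]_d) (x : 'rV[R]_d) : 'rV[R]_d :=
  \row_j divergence (fun y => (rho y * u y 0 j) *: u y) x.

(* Radial profiles are read off along the first coordinate axis.  They are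
   defined for all real r: the profile of a radial scalar field is even, that
   of a radial vector field is odd.  Hence for differentiable fields the
   r-derivative at r = 0 is two-sided, and the conditions
   (d/dr rho)(0) = 0, u(0) = 0, (d/dr phi)(0) = 0 hold automatically. *)
Definition profile (R : realType) (n : nat) (f : 'rV[R]_n.+1 -> R) (r : R) : R :=
  f (r *: delta_mx 0 0).

Definition vprofile (R : realType) (n : nat)
  (u : 'rV[R]_n.+1 -> 'rV[R]_n.+1) (r : R) : R :=
  u (r *: delta_mx 0 0) 0 0.

Definition radial (R : realType) (n : nat) (f : 'rV[R]_n.+1 -> R) : Prop :=
  forall x, f x = profile f (enorm x).

(* Radial without swirl; at x = 0 this says u 0 = 0. *)
Definition vradial (R : realType) (n : nat)
  (u : 'rV[R]_n.+1 -> 'rV[R]_n.+1) : Prop :=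
  forall x, u x = (vprofile u (enorm x) / enorm x) *: x.

(* f is C^1 on (0,oo) x R^d, and f and its spatial gradient are continuous up
   to t = 0. *)
Record C1_field (R : realType) (d : nat) (V : normedModType R)
    (f : R -> 'rV[R]_d -> V) : Prop := {
  C1_cont : {within [set p : R * 'rV[R]_d | 0 <= p.1],
    continuous (fun p => f p.1 p.2)} ;
  C1_space : forall (t : R) (x : 'rV[R]_d), 0 <= t -> differentiable (f t) x ;
  C1_space_cont : forall i : 'I_d, {within [set p : R * 'rV[R]_d | 0 <= p.1],
    continuous (fun p => 'D_(delta_mx 0 i) (f p.1) p.2)} ;
  C1_joint : forall p : R^o * 'rV[R]_d, 0 < p.1 ->
    differentiable (fun q : R^o * 'rV[R]_d => f q.1 q.2) p ;
  C1_time_cont : {within [set p : R * 'rV[R]_d | 0 < p.1],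
    continuous (fun p => derive1 (fun s => f s p.2) p.1)} }.

(* f is twice continuously differentiable in x, continuously in t. *)
Record C2_space_field (R : realType) (d : nat) (f : R -> 'rV[R]_d -> R) :
    Prop := {
  C2_cont : {within [set p : R * 'rV[R]_d | 0 <= p.1],
    continuous (fun p => f p.1 p.2)} ;
  C2_diff : forall (t : R) (x : 'rV[R]_d), 0 <= t -> differentiable (f t) x ;
  C2_grad_cont : {within [set p : R * 'rV[R]_d | 0 <= p.1],
    continuous (fun p => grad (f p.1) p.2)} ;
  C2_grad_diff : forall (t : R) (x : 'rV[R]_d), 0 <= t -> differentiable (grad (f t)) x ;
  C2_hess_cont : {within [set p : R * 'rV[R]_d | 0 <= p.1],
    continuous (fun p => hessian (f p.1) p.2)} }.

(* Supremum norm, which is the L^oo norm for continuous fields.  On row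
   vectors and matrices `|_| is the largest absolute value of an entry. *)
Definition Linfty (R : realType) (d : nat) (V : normedModType R)
  (f : 'rV[R]_d -> V) : \bar R :=
  ereal_sup [set `|f x|%:E | x in [set: 'rV[R]_d]].

(* L^oo norm of the list: gradient of u, u, rho - 1, phi_rr, phi_r. *)
Definition state_norm (R : realType) (n : nat) (rho : 'rV[R]_n.+1 -> R)
  (u : 'rV[R]_n.+1 -> 'rV[R]_n.+1) (phi : 'rV[R]_n.+1 -> R) : \bar R :=
  maxe (Linfty (fun x => 'J u x))
 (maxe (Linfty u)
 (maxe (Linfty (fun x => rho x - 1))
 (maxe (Linfty (fun x : 'rV[R]_n.+1 => derive1 (derive1 (profile phi)) (enorm x)))
       (Linfty (fun x : 'rV[R]_n.+1 => derive1 (profile phi) (enorm x)))))).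

(* Global classical radial solutions.  The last two fields are the qualitative
   boundedness that belongs to the solution class: finite initial norm, and
   gradient of u bounded on every finite time slab.  Without them the solution
   may be unbounded at spatial infinity at some time, and then there is no
   decay estimate. *)
Record global_radial_solution (R : realType) (n : nat) (kappa beta : R)
    (rho : R -> 'rV[R]_n.+1 -> R) (u : R -> 'rV[R]_n.+1 -> 'rV[R]_n.+1)
    (phi : R -> 'rV[R]_n.+1 -> R) : Prop := {
  rho_C1 : C1_field rho ;
  u_C1 : C1_field u ;
  phi_C2 : C2_space_field phi ;
  rho_radial : forall t : R, 0 <= t -> radial (rho t) ;
  u_radial : forall t : R, 0 <= t -> vradial (u t) ;
  phi_radial : forall t : R, 0 <= t -> radial (phi t) ;
  phi_normalized : forall t : R, 0 <= t -> phi t 0 = 0 ;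
  mass_eq : forall (t : R) (x : 'rV[R]_n.+1), 0 < t ->
    derive1 (fun s => rho s x) t + divergence (fun y => rho t y *: u t y) x = 0 ;
  momentum_eq : forall (t : R) (x : 'rV[R]_n.+1), 0 < t ->
    derive1 (fun s => rho s x *: u s x) t + div_flux (rho t) (u t) x =
      - ((kappa * rho t x) *: grad (phi t) x) - (beta * rho t x) *: u t x ;
  monge_ampere_eq : forall (t : R) (x : 'rV[R]_n.+1), 0 <= t ->
    \det (1%:M - hessian (phi t) x) = rho t x ;
  initial_norm_finite : (state_norm (rho 0%R) (u 0%R) (phi 0%R) < +oo)%E ;
  grad_u_bounded_on_slabs : forall T : R, exists M : R,
    forall t, 0 <= t <= T -> (Linfty (fun x => 'J (u t) x) <= M%:E)%E }.

Definition has_initial_profiles (R : realType) (n : nat)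
  (rho : 'rV[R]_n.+1 -> R) (u : 'rV[R]_n.+1 -> 'rV[R]_n.+1)
  (phi : 'rV[R]_n.+1 -> R) (rho0 u0 phi0 : R -> R) : Prop :=
  forall r, 0 <= r ->
    [/\ profile rho r = rho0 r, vprofile u r = u0 r & profile phi r = phi0 r].

(* phi0'' < 1, uniformly in r.  For data whose second derivative tends to 0 at
   infinity this is the same as phi0''(r) < 1 for all r; without uniformity the
   density may approach vacuum at infinity and the decay estimate fails. *)
Definition nonvacuous (R : realType) (phi0 : R -> R) : Prop :=
  exists2 c : R, 0 < c & forall r, 0 < r -> derive1 (derive1 phi0) r <= 1 - c.

Definition decay_indicator (R : realType) (lam : R) (u0 phi0 : R -> R)
  (r : R) : R :=
  (derive1 u0 r + lam * derive1 (derive1 phi0) r) / (1 - derive1 (derive1 phi0) r).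

(* Exponential decay at rate gamma of every global solution in dimension n.+1
   with the given initial profiles; C is chosen before the solution, so it
   depends only on the parameters and the initial profiles. *)
Definition decays_at_rate (R : realType) (n : nat) (kappa beta : R)
  (rho0 u0 phi0 : R -> R) (gamma : R) : Prop :=
  exists2 C : R, 0 < C &
    forall (rho : R -> 'rV[R]_n.+1 -> R) (u : R -> 'rV[R]_n.+1 -> 'rV[R]_n.+1)
      (phi : R -> 'rV[R]_n.+1 -> R),
    global_radial_solution kappa beta rho u phi ->
    has_initial_profiles (rho 0) (u 0) (phi 0) rho0 u0 phi0 ->
    forall t, 0 <= t ->
      (state_norm (rho t) (u t) (phi t) <= (C * expR (- gamma * t))%:E)%E.

(* Main.v *)
Require Import Defs.
From mathcomp Require Import all_boot all_order all_algebra.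
From mathcomp Require Import all_classical all_reals all_analysis.
From mathcomp Require Import ring lra.
Import Order.TTheory GRing.Theory Num.Theory.
Import numFieldNormedType.Exports.
Local Open Scope ring_scope.

(** In radial variables write [w] for the radial derivative of [phi], [v] for
the radial velocity and [d = n + 1] for the dimension.  The Monge-Ampere
equation makes [(r - w)^d] proportional to the mass inside radius [r], so mass
conservation says that [r - w] is transported by the flow, while the momentum
equation becomes [Dv = - kappa w - beta v] along characteristics.  Hence
[w'' + beta w' + kappa w = 0] along each characteristic: both the
characteristic from [a], namely [X t a = a - w 0 a + W t a], and the solution
on it are explicit, and a Gronwall estimate shows that the given solution agrees
with the explicit one (no existence theory for characteristics is needed).
Differentiating in [a] gives [w_r X_a = W_a] and [v_r X_a = V_a], where [W_a]
and [V_a] solve the same linear equation.  The bound on the velocity gradient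
on time slabs keeps [X_a] away from 0 for bounded times, and the decay of [W_a]
does so for large times; so all quantities decay like the solutions of the
damped oscillator. *)

Set Implicit Arguments.
Unset Strict Implicit.
Unset Printing Implicit Defensive.


(** * Calculus on the real line *)

Section Calculus.
Context {R : realType}.
Local Open Scope classical_set_scope.
Implicit Types (f g : R -> R) (x : R).

Lemma is_deriveD_fun f g x df dg : is_derive x 1 f df -> is_derive x 1 g dg ->
  is_derive x 1 (fun y => f y + g y) (df + dg).
Proof. by move=> hf hg; exact: is_deriveD. Qed.

Lemma is_deriveN_fun f x df : is_derive x 1 f df ->
  is_derive x 1 (fun y => - f y) (- df).
Proof. by move=> hf; exact: is_deriveN. Qed.

Lemma is_deriveM_fun f g x df dg : is_derive x 1 f df -> is_derive x 1 g dg ->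
  is_derive x 1 (fun y => f y * g y) (df * g x + f x * dg).
Proof.
move=> hf hg; have h := @is_deriveM _ _ f g x 1 df dg hf hg.
by apply: (is_derive_eq h); rewrite addrC; congr (_ + _); exact: mulrC.
Qed.

Lemma is_deriveX_fun f n x df : is_derive x 1 f df ->
  is_derive x 1 (fun y => f y ^+ n) (n%:R * f x ^+ n.-1 * df).
Proof.
move=> hf; rewrite (_ : (fun y => _) = f ^+ n); last first.
  by apply/funext => y; rewrite exprfctE.
exact: (@is_deriveX _ _ f n x 1 df).
Qed.

Lemma is_derive_comp_fun f g x df dg : is_derive (g x) 1 f df ->
  is_derive x 1 g dg -> is_derive x 1 (fun y => f (g y)) (df * dg).
Proof. by move=> hf hg; exact: is_derive1_comp. Qed.

Lemma derivable1_derive1 f x : derivable f x 1 -> is_derive x 1 f (f^`() x).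
Proof. by move=> h; rewrite derive1E; exact: derivableP. Qed.

Lemma derive1_val f x df : is_derive x 1 f df -> f^`() x = df.
Proof. by move=> h; rewrite derive1E derive_val. Qed.

Lemma is_derive1_unique f x d1 d2 :
  is_derive x 1 f d1 -> is_derive x 1 f d2 -> d1 = d2.
Proof. by move=> /derive1_val <- /derive1_val. Qed.

End Calculus.

Ltac derive_step :=
  lazymatch goal with
  | |- is_derive _ _ (fun y => _ + _) _ => eapply is_deriveD_fun
  | |- is_derive _ _ (fun y => - _) _ => eapply is_deriveN_fun
  | |- is_derive _ _ (fun y => _ * _) _ => eapply is_deriveM_fun
  | |- is_derive _ _ (fun y => _ ^+ _) _ => eapply is_deriveX_fun
  | |- is_derive _ _ (fun y => y) _ => eapply is_derive_id
  | |- is_derive _ _ (fun y => expR _) _ =>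
      eapply (@is_derive_comp_fun _ expR); [exact: is_derive_expR|]
  | |- is_derive _ _ (fun y => sin _) _ =>
      eapply (@is_derive_comp_fun _ sin); [exact: is_derive_sin|]
  | |- is_derive _ _ (fun y => cos _) _ =>
      eapply (@is_derive_comp_fun _ cos); [exact: is_derive_cos|]
  (* unification eta-contracts [fun y => c * y] *)
  | |- is_derive ?x ?v ( *%R ?c) ?d =>
      change (is_derive x v (fun y => c * y) d); eapply is_deriveM_fun
  | |- is_derive _ _ (fun y => ?c) _ => eapply is_derive_cst
  end.
(** Derivatives of opaque functions are taken from the context; what remains is the identity between
    the computed derivative and the stated one. *)
Ltac derive_tac := eapply is_derive_eq; [repeat (eassumption || derive_step) |].

Section RealFunctions.
Context {R : realType}.
Implicit Types (f g : R -> R) (x : R).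
Local Open Scope classical_set_scope.

Lemma is_derive_continuous f x df : is_derive x 1 f df -> {for x, continuous f}.
Proof.
by move=> h; apply: differentiable_continuous; apply/derivable1_diffP; exact: ex_derive.
Qed.

Lemma MVT_is_derive f (df : R -> R) (a b : R) : a <= b ->
  (forall x, a <= x <= b -> is_derive x 1 f (df x)) ->
  exists2 c, a <= c <= b & f b - f a = df c * (b - a).
Proof.
move=> ab h; have [||c cab ->] := @MVT_segment R f df a b ab.
- by move=> x; rewrite in_itv /= => /andP[ax xb]; apply: h; rewrite !ltW.
- apply: derivable_within_continuous => x; rewrite in_itv /= => xab.
  by have := h x xab => hx; exact: ex_derive.
- by exists c => //; rewrite in_itv /= in cab.
Qed.

Lemma MVT_from0 f (df : R -> R) (r : R) : 0 < r -> f 0 = 0 ->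
  (forall x, is_derive x 1 f (df x)) -> exists2 c, 0 < c < r & f r = df c * r.
Proof.
move=> r0 f0 h; have [|c] := MVT r0 (fun x _ => h x).
  by apply: derivable_within_continuous => x _; have := h x => hx; exact: ex_derive.
by rewrite in_itv /= f0 !subr0 => c0r ->; exists c.
Qed.

Lemma norm_le_of_slope f (df : R -> R) (M r : R) : f 0 = 0 ->
  (forall x, is_derive x 1 f (df x)) -> (forall x, 0 < x -> `|df x| <= M) ->
  0 < r -> `|f r| <= M * r.
Proof.
move=> f0 h hM r0; have [c /andP[c0 _] ->] := MVT_from0 r0 f0 h.
by rewrite normrM (gtr0_norm r0) ler_wpM2r ?(ltW r0)// hM.
Qed.

Lemma ge_of_slope f (df : R -> R) (m r : R) : f 0 = 0 ->
  (forall x, is_derive x 1 f (df x)) -> (forall x, 0 < x -> m <= df x) ->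
  0 < r -> m * r <= f r.
Proof.
move=> f0 h hM r0; have [c /andP[c0 _] ->] := MVT_from0 r0 f0 h.
by rewrite ler_wpM2r ?(ltW r0)// hM.
Qed.

Lemma nonincreasing_is_derive f (df : R -> R) (a b : R) : a <= b ->
  continuous f -> (forall x, a < x < b -> is_derive x 1 f (df x)) ->
  (forall x, a < x < b -> df x <= 0) -> f b <= f a.
Proof.
move=> ab cf h h0.
have H : {in `[a, b]%R &, {homo f : x y /~ x <= y}}.
  apply: ler0_derive1_le_cc.
  - by move=> x; rewrite in_itv /= => /h hx; exact: ex_derive.
  - by move=> x; rewrite in_itv /= => xab; rewrite (derive1_val (h _ xab)) h0.
  - exact: continuous_subspaceT.
by apply: H => //; rewrite in_itv /= lexx ?andbT.
Qed.

(** Meant for a remainder that is only estimated, never computed: its difference quotients at [t]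
    fall below every [eps]. *)
Lemma is_derive_little f t : f t = 0 ->
  (forall eps, 0 < eps -> \forall s \near t, `|f s| <= eps * `|s - t|) ->
  is_derive t 1 f 0.
Proof.
move=> f0 h.
suff H : h^-1 *: (f (h *: 1 + t) - f t) @[h --> 0^'] --> (0 : R).
  apply: DeriveDef; first by apply/cvg_ex; exists 0.
  exact/cvg_lim.
apply/cvgrPdist_le => e e0.
have := h e e0 => /nbhs_ballP[d /= d0 hd].
near=> k.
have k0 : k != 0 by near: k; exact: nbhs_dnbhs_neq.
rewrite f0 subr0 sub0r normrN /GRing.scale /= mulr1 normrM normfV.
rewrite ler_pdivrMl ?normr_gt0// mulrC.
have := hd (k + t); rewrite addrK; apply.
rewrite /ball /= opprD addrC subrK normrN.
by near: k; exact: dnbhs0_lt.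
Unshelve. all: by end_near. Qed.

(** At the infimum of the times where [f <= 0] the step hypothesis gives [f > 0], and continuity
    extends this to the right, away from the infimum. *)
Lemma positive_bootstrap f (a : R) : continuous f -> 0 < f a ->
  (forall t, a < t -> (forall s, a <= s < t -> 0 < f s) -> 0 < f t) ->
  forall t, a <= t -> 0 < f t.
Proof.
move=> cf f0 step t1 t1a; rewrite ltNge; apply/negP => ft1.
pose A := [set t | a <= t /\ f t <= 0].
have A1 : A t1 by split.
have hA : has_inf A by split; [exists t1|exists a => x []].
set t := inf A.
have at_ : a <= t by apply: lb_le_inf; [exists t1|move=> x []].
have pos s : a <= s < t -> 0 < f s.
  move=> /andP[as_ st]; rewrite ltNge; apply/negP => fs.
  by have := @ge_inf R A hA.2 s (conj as_ fs); rewrite leNgt st.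
have ft : 0 < f t.
  have [->//|ne] := eqVneq t a.
  by apply: step => //; rewrite lt_neqAle eq_sym ne.
have := cf t => /cvgrPdist_lt /(_ _ ft) /nbhs_ballP[d /= d0 hd].
have [x Ax xt] := inf_adherent d0 hA.
have tx : t <= x by exact: (ge_inf hA.2).
have : `|f t - f x| < f t.
  by apply: hd; rewrite /ball /= distrC ger0_norm ?subr_ge0// ltrBlDl.
rewrite ltr_norml => /andP[_]; rewrite ltrBlDr ltrDl.
by rewrite ltNge; case: Ax => _ ->.
Qed.

Lemma ge0_left_limit f (a t : R) : a < t -> {for t, continuous f} ->
  (forall s, a <= s < t -> 0 < f s) -> 0 <= f t.
Proof.
move=> at_ cf h; rewrite leNgt; apply/negP => ft.
have := cf => /cvgrPdist_lt /(_ (- f t)); rewrite oppr_gt0 => /(_ ft).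
move=> /nbhs_ballP[d /= d0 hd].
pose s := Num.max a (t - d / 2).
have st : s < t by rewrite gt_max at_ /= ltrBlDr ltrDl divr_gt0.
have as_ : a <= s by rewrite le_max lexx.
have : `|f t - f s| < - f t.
  apply: hd; rewrite /ball /= gtr0_norm ?subr_gt0//.
  rewrite ltrBlDr -ltrBlDl.
  apply: (@lt_le_trans _ _ (t - d / 2)); last by rewrite le_max lexx orbT.
  by rewrite ltrD2l ltrN2 ltr_pdivrMr// ltr_pMr// ltr1n.
have := h s; rewrite as_ st => /(_ isT) fs.
by rewrite ltr_norml => /andP[]; rewrite opprK; lra.
Qed.

(** Near a positive time the clamp is the identity; this reconciles derivatives for [t > 0] with
    continuity on the whole line. *)
Lemma clamp_is_derive (f : R -> R -> R) (X : R -> R) (t d : R) : 0 < t ->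
  is_derive t 1 (fun s => f s (X s)) d ->
  is_derive t 1 (fun s => f (Num.max s 0) (X s)) d.
Proof.
move=> t0; apply: near_eq_is_derive; near=> s.
by rewrite max_l//; apply: ltW; near: s; exact: lt_nbhsr.
Unshelve. all: by end_near. Qed.

(** In the factorisation of [e ^+ n.+1 - b ^+ n.+1] by [e - b], only the term [b ^+ n] of the
    cofactor is kept. It lets an error in the power control the error in its root. *)
Lemma norm_subX_ge (e b : R) n : 0 <= e -> 0 <= b ->
  `|e - b| * b ^+ n <= `|e ^+ n.+1 - b ^+ n.+1|.
Proof.
move=> e0 b0; rewrite subrXX normrM ler_wpM2l//.
apply: le_trans (ler_norm _); rewrite big_ord_recr /= subnn expr0 mul1r lerDr.
by apply: sumr_ge0 => i _; rewrite mulr_ge0 ?exprn_ge0.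
Qed.

Lemma continuous_expr f m : continuous f -> continuous (fun x => f x ^+ m).
Proof.
by move=> cf x; exact: (continuous_comp (cf x) (@exprn_continuous R m (f x))).
Qed.

Lemma mx_entry_le (p q : nat) (A : 'M[R]_(p, q)) i j : `|A i j| <= `|A|.
Proof.
rewrite [leRHS]/Num.Def.normr /= mx_normrE.
exact: (le_bigmax _ (fun ij : 'I_p * 'I_q => `|A ij.1 ij.2|) (i, j)).
Qed.

End RealFunctions.


(** * The radial system *)

(* Continuity up to the initial time is stated by clamping the time to
   [0 <= t]. *)
Record radial_flow (R : realType) (n : nat) (kappa beta : R)
    (rho v w : R -> R -> R) : Prop := {
  rf_rho_cont : forall X : R -> R, continuous X ->
    continuous (fun t : R => rho (Num.max t 0) (X t)) ;
  rf_v_cont : forall X : R -> R, continuous X ->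
    continuous (fun t : R => v (Num.max t 0) (X t)) ;
  rf_w_cont : forall X : R -> R, continuous X ->
    continuous (fun t : R => w (Num.max t 0) (X t)) ;
  rf_rho_derivable : forall t r : R, 0 <= t -> derivable (rho t) r 1 ;
  rf_v_derivable : forall t r : R, 0 <= t -> derivable (v t) r 1 ;
  rf_w_derivable : forall t r : R, 0 <= t -> derivable (w t) r 1 ;
  rf_v0 : forall t : R, 0 <= t -> v t 0 = 0 ;
  rf_w0 : forall t : R, 0 <= t -> w t 0 = 0 ;
  rf_rho_along : forall (X : R -> R) (t dX : R), 0 < t -> is_derive t 1 X dX ->
    is_derive t 1 (fun s => rho s (X s))
      (derive1 (fun s => rho s (X t)) t + dX * derive1 (rho t) (X t)) ;
  rf_v_along : forall (X : R -> R) (t dX : R), 0 < t -> is_derive t 1 X dX ->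
    is_derive t 1 (fun s => v s (X s))
      (derive1 (fun s => v s (X t)) t + dX * derive1 (v t) (X t)) ;
  rf_rhot_cont : forall t r : R, 0 < t ->
    {for (t, r), continuous (fun p : R * R => derive1 (fun s => rho s p.2) p.1)} ;
  rf_mass : forall t r : R, 0 < t -> 0 < r ->
    derive1 (fun s => rho s r) t + (derive1 (rho t) r * v t r +
      rho t r * derive1 (v t) r) + n%:R * (rho t r * v t r / r) = 0 ;
  rf_momentum : forall t r : R, 0 < t -> 0 < r ->
    rho t r * (derive1 (fun s => v s r) t + v t r * derive1 (v t) r +
      kappa * w t r + beta * v t r) = 0 ;
  rf_density : forall t r : R, 0 <= t -> 0 < r ->
    rho t r = (1 - derive1 (w t) r) * (1 - w t r / r) ^+ n ;
  rf_slab : forall T : R, exists M : R, forall t r : R, 0 <= t <= T -> 0 < r ->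
    `|derive1 (v t) r| <= M }.

Section UniformTime.
Context {R : realType}.
Local Open Scope classical_set_scope.

(** Compactness of the segment turns continuity at each point of the slice at time [t] into one
    neighbourhood of [t] valid for all radii; both values are compared with the one at the centre of
    the covering neighbourhood. *)
Lemma uniform_near_time (f : R * R -> R) (t L : R) :
  (forall r, {for (t, r), continuous f}) -> forall eps, 0 < eps ->
  \forall s \near t, forall r, 0 <= r <= L -> `|f (s, r) - f (t, r)| <= eps.
Proof.
move=> cf eps e0.
have /compact_near_coveringP H : compact `[0, L] by exact: segment_compact.
have [r _|d /= d0 hd] := H R (nbhs t) (fun s r => `|f (s, r) - f (t, r)| <= eps) (nbhs_filter t).
  have := cf r => /cvgrPdist_lt /(_ (eps / 2)); rewrite divr_gt0// => /(_ isT).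
  move=> hn.
  have hn2 : \forall p \near (r, t), `|f (t, r) - f (p.2, p.1)| < eps / 2.
    have c : (p.2, p.1) @[p --> (r, t)] --> (t, r).
      by apply: (@cvg_pair _ _ _ _ (nbhs t) (nbhs r)); [exact: cvg_snd|exact: cvg_fst].
    exact: (c _ hn).
  have hn3 : \forall p \near (r, t), `|f (t, r) - f (t, p.1)| < eps / 2.
    have c : (t, p.1) @[p --> (r, t)] --> (t, r).
      by apply: (@cvg_pair _ _ _ _ (nbhs t) (nbhs r)); [exact: cvg_cst|exact: cvg_fst].
    exact: (c _ hn).
  near=> p.
  have h2 : `|f (t, r) - f (p.2, p.1)| < eps / 2 by near: p.
  have h3 : `|f (t, r) - f (t, p.1)| < eps / 2 by near: p.
  rewrite (_ : f (p.2, p.1) - _ = (f (t, r) - f (t, p.1)) - (f (t, r) - f (p.2, p.1))); last by ring.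
  apply: (le_trans (ler_normB _ _)); lra.
by exists d => //= s hs r hr; apply: hd => //=; rewrite in_itv.
Unshelve. all: by end_near. Qed.
End UniformTime.

(** * Transport of the enclosed mass *)

Section Flow.
Context {R : realType} {n : nat} {kappa beta : R} {rho v w : R -> R -> R}.
Hypothesis F : radial_flow n kappa beta rho v w.
Local Open Scope classical_set_scope.

Lemma rho_is_derive (t r : R) : 0 <= t -> is_derive r 1 (rho t) ((rho t)^`() r).
Proof. by move=> t0; apply/derivable1_derive1/(rf_rho_derivable F). Qed.
Lemma v_is_derive (t r : R) : 0 <= t -> is_derive r 1 (v t) ((v t)^`() r).
Proof. by move=> t0; apply/derivable1_derive1/(rf_v_derivable F). Qed.
Lemma w_is_derive (t r : R) : 0 <= t -> is_derive r 1 (w t) ((w t)^`() r).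
Proof. by move=> t0; apply/derivable1_derive1/(rf_w_derivable F). Qed.

Lemma rhot_is_derive (t r : R) : 0 < t ->
  is_derive t 1 (fun s => rho s r) ((fun s => rho s r)^`() t).
Proof.
move=> t0; have := rf_rho_along F t0 (is_derive_cst r t 1).
by rewrite mul0r addr0.
Qed.

(** Since [r ^+ n * (1 - w / r) ^+ n = (r - w) ^+ n], the radial Monge-Ampere density weighted by
    [r ^+ n] is an exact derivative. *)
Lemma cmass_is_derive (t r : R) : 0 <= t -> 0 < r ->
  is_derive r 1 (fun x => (x - w t x) ^+ n.+1) (n.+1%:R * (r ^+ n * rho t r)).
Proof.
move=> t0 r0; have hw := w_is_derive r t0.
derive_tac; rewrite /= (rf_density F)//.
have rn : r != 0 by rewrite gt_eqF.
rewrite (_ : r - w t r = r * (1 - w t r / r)); last by field.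
by rewrite exprMn; ring.
Qed.

Lemma mass_flux_is_derive (t r : R) : 0 < t -> 0 < r ->
  is_derive r 1 (fun x => x ^+ n * (rho t x * v t x))
    (- (r ^+ n * derive1 (fun s => rho s r) t)).
Proof.
move=> t0 r0; have hv := v_is_derive r (ltW t0).
have hr := rho_is_derive r (ltW t0).
derive_tac; rewrite /=.
have := rf_mass F t0 r0.
have rn : r != 0 by rewrite gt_eqF.
move/eqP; rewrite -addrA addr_eq0 => /eqP ->.
(* For [n = 0] the exponent [n.-1] is truncated to 0, and both sides vanish through the factor
   [n%:R]. *)
rewrite (_ : n%:R * r ^+ n.-1 * 1 = r ^+ n * (n%:R / r)); last first.
  case: n => [|m]; first by rewrite !mul0r mulr0.
  by rewrite exprS /=; field.
ring.
Qed.

(* [w] is only continuous in time, so the derivative of the mass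
   [(X - w)^(n+1)] enclosed by the curve is obtained by integrating the
   continuity equation in space: a mean value argument in [r] and [s]. *)
Lemma cmass_along (X : R -> R) (t dX : R) : 0 < t -> 0 < X t ->
  is_derive t 1 X dX ->
  is_derive t 1 (fun s => (X s - w s (X s)) ^+ n.+1)
    (n.+1%:R * (X t ^+ n * rho t (X t)) * (dX - v t (X t))).
Proof.
move=> t0 X0 hX.
have t0' := ltW t0.
(* By the continuity equation [- Q] is the formal time derivative of [G] at fixed radius; [E] is the
   first-order remainder, taken at the moving radius. *)
pose G s r := (r - w s r) ^+ n.+1.
pose Q r := n.+1%:R * (r ^+ n * (rho t r * v t r)).
pose E s := G s (X s) - G t (X s) + (s - t) * Q (X s).
have hE : is_derive t 1 E 0.
  apply: is_derive_little; first by rewrite /E !subrr mul0r addr0.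
  move=> eps e0.
  pose L := X t + 1.
  have L0 : 0 < L by rewrite addr_gt0.
  (* The remainder will be at most [L * (n.+1%:R * L ^+ n)] times the variation of the time
     derivative of [rho], times the length of the time step. *)
  pose eps' := eps / (L * (n.+1%:R * L ^+ n)).
  have C0 : 0 < L * (n.+1%:R * L ^+ n) by rewrite !mulr_gt0// exprn_gt0.
  have e'0 : 0 < eps' by rewrite divr_gt0.
  have hu := @uniform_near_time _ (fun p : R * R => derive1 (fun s => rho s p.2) p.1)
    t L (fun r => @rf_rhot_cont _ _ _ _ _ _ _ F t r t0) eps' e'0.
  have [d /= d0 hd] : exists2 d, 0 < d & forall s, `|t - s| < d -> 
      0 < s /\ forall r, 0 <= r <= L ->
     `|derive1 (fun s => rho s r) s - derive1 (fun s => rho s r) t| <= eps'.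
    have : \forall s \near t, 0 < s /\ forall r, 0 <= r <= L ->
     `|derive1 (fun s => rho s r) s - derive1 (fun s => rho s r) t| <= eps'.
      by near=> s; split; [near: s; exact: lt_nbhsr|near: s].
    by case/nbhs_ballP => d /= d0 hd; exists d.
  have cX := is_derive_continuous hX.
  have X0near : \forall s \near t, 0 < X s < L.
    near=> s; apply/andP; split; near: s.
      exact: (cX [set y | 0 < y] (lt_nbhsr X0)).
    have XL : X t < L by rewrite ltrDl.
    exact: (cX [set y | y < L] (lt_nbhsl XL)).
  near=> s.
  have sd : `|t - s| < d by near: s; exact: (nbhsx_ballx t d d0).
  have /andP[Xs0 XsL] : 0 < X s < L by near: s.
  have s0 : 0 <= s by have [/ltW] := hd s sd.
  pose e r := G s r - G t r + (s - t) * Q r.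
  pose de r := n.+1%:R * (r ^+ n * (rho s r - rho t r -
      (s - t) * derive1 (fun s => rho s r) t)).
  have hder (r : R) : 0 < r -> is_derive r 1 e (de r).
    move=> r0.
    have h1 := cmass_is_derive s0 r0; have h2 := cmass_is_derive t0' r0.
    have h3 := mass_flux_is_derive t0 r0.
    by rewrite /e /G /Q; derive_tac; rewrite /de /=; ring.
  have e00 : e 0 = 0.
    by rewrite /e /G /Q (rf_w0 F s0) (rf_w0 F t0') (rf_v0 F t0') !subrr !mulr0 addr0.
  have [||c] := @MVT_segment R e de 0 (X s) (ltW Xs0).
  - by move=> r; rewrite in_itv /= => /andP[/hder].
  - apply: derivable_within_continuous => r _.
    have hs := w_is_derive r s0; have ht := w_is_derive r t0'.
    have hr := rho_is_derive r t0'; have hv := v_is_derive r t0'.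
    apply: (@ex_derive _ _ _ _ _ e _).
    by rewrite /e /G /Q; derive_tac.
  rewrite in_itv /= e00 !subr0 => /andP[c0 cX'].
  rewrite -[E s]/(e (X s)) => ->.
  (* [de c] contains the first-order time remainder of [rho] at the fixed radius [c]; it is bounded
     by the mean value theorem for [q] between [t] and [s], on either side of [t]. *)
  have hde : `|rho s c - rho t c - (s - t) * derive1 (fun s => rho s c) t| <= eps' * `|s - t|.
    pose q x := rho x c - (x - t) * derive1 (fun s => rho s c) t.
    have main (a b : R) : a <= b -> (forall x, a <= x <= b -> `|t - x| < d) -> 
        `|q b - q a| <= eps' * `|b - a|.
      move=> ab hab.
      have [x xab|x xab ->] := @MVT_is_derive _ q
        (fun x => derive1 (fun s => rho s c) x - derive1 (fun s => rho s c) t) a b ab.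
        have [x0 _] := hd x (hab x xab).
        have hx := rhot_is_derive c x0.
        by rewrite /q; derive_tac; rewrite /=; ring.
      rewrite normrM ler_wpM2r//.
      have [_] := hd x (hab x xab); apply.
      by rewrite c0 (le_trans cX')// ltW.
    have -> : rho s c - rho t c - (s - t) * derive1 (fun s => rho s c) t = q s - q t.
      by rewrite /q; ring.
    have [st|ts] := leP s t.
      rewrite distrC [`|s - t|]distrC; apply: main => // x /andP[sx xt].
      rewrite ger0_norm ?subr_ge0//; apply: le_lt_trans sd.
      by rewrite ger0_norm ?subr_ge0// lerD2l lerN2.
    apply: main; first exact: ltW.
    move=> x /andP[tx xs]; rewrite distrC ger0_norm ?subr_ge0//.
    apply: le_lt_trans sd; rewrite distrC ger0_norm ?subr_ge0 ?(ltW ts)//.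
    by rewrite lerD2r.
  rewrite /de !normrM (ger0_norm (ltW Xs0)) normrX (ger0_norm c0) normr_nat.
  have cn : c ^+ n <= L ^+ n.
    by rewrite lerXn2r ?nnegrE// ?(ltW L0)// (le_trans cX')// ltW.
  have -> : eps * `|s - t| = (n.+1%:R * (L ^+ n * (eps' * `|s - t|))) * L.
    rewrite /eps'; field.
    by rewrite !gt_eqF// exprn_gt0.
  rewrite ler_pM ?mulr_ge0 ?exprn_ge0 ?(ltW Xs0)//; last exact: ltW.
  by rewrite ler_wpM2l// ler_pM// exprn_ge0.
have hG := cmass_is_derive t0' X0.
have hGX := @is_derive_comp_fun _ (fun x => (x - w t x) ^+ n.+1) X t _ _ hG hX.
have hr := is_derive_comp_fun (rho_is_derive (X t) t0') hX.
have hv := is_derive_comp_fun (v_is_derive (X t) t0') hX.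
(* Only [E] contains [w] at a varying time, and its derivative at [t] vanishes; the chain rule in
   space handles the other terms. *)
have -> : (fun s => (X s - w s (X s)) ^+ n.+1) =
  fun s => G t (X s) + E s - (s - t) * Q (X s).
  by apply/funext => s; rewrite /E /G; ring.
rewrite /G /Q; derive_tac; rewrite /=; ring.
Unshelve. all: by end_near. Qed.

End Flow.


(** * Characteristics *)

(** Fundamental solutions of [y'' + beta y' + kappa y = 0] with their derivatives, kept abstract so
    that the analysis of characteristics serves all three regimes. *)
Record damped_basis (R : realType) (kappa beta : R) (y1 z1 y2 z2 : R -> R) :
    Prop := {
  db_y1 : forall t : R, is_derive t 1 y1 (z1 t) ;
  db_z1 : forall t : R, is_derive t 1 z1 (- kappa * y1 t - beta * z1 t) ;
  db_y2 : forall t : R, is_derive t 1 y2 (z2 t) ;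
  db_z2 : forall t : R, is_derive t 1 z2 (- kappa * y2 t - beta * z2 t) ;
  db_init : [/\ y1 0 = 1, z1 0 = 0, y2 0 = 0 & z2 0 = 1] }.

Section Characteristics.
Context {R : realType} {n : nat} {kappa beta : R} {rho v w : R -> R -> R}.
Hypothesis F : radial_flow n kappa beta rho v w.
Context {y1 z1 y2 z2 : R -> R}.
Hypothesis B : damped_basis kappa beta y1 z1 y2 z2.
Local Open Scope classical_set_scope.


Definition disp a t := w 0 a * y1 t + v 0 a * y2 t.
Definition vel a t := w 0 a * z1 t + v 0 a * z2 t.
Definition pos a t := a - w 0 a + disp a t.

Lemma disp_is_derive (a t : R) : is_derive t 1 (disp a) (vel a t).
Proof.
have h1 := db_y1 B t; have h2 := db_y2 B t.
by rewrite /disp /vel; derive_tac; rewrite /=; ring.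
Qed.

Lemma vel_is_derive (a t : R) :
  is_derive t 1 (vel a) (- kappa * disp a t - beta * vel a t).
Proof.
have h1 := db_z1 B t; have h2 := db_z2 B t.
by rewrite /disp /vel; derive_tac; rewrite /=; ring.
Qed.

Lemma pos_is_derive (a t : R) : is_derive t 1 (pos a) (vel a t).
Proof.
have h := disp_is_derive a t.
by rewrite /pos; derive_tac; rewrite /=; ring.
Qed.

Lemma pos_continuous a : continuous (pos a).
Proof. by move=> t; exact: is_derive_continuous (pos_is_derive a t). Qed.

Lemma vel_continuous a : continuous (vel a).
Proof. by move=> t; exact: is_derive_continuous (vel_is_derive a t). Qed.

Lemma disp0 a : disp a 0 = w 0 a.
Proof. by case: (db_init B) => h1 _ h2 _; rewrite /disp h1 h2 mulr1 mulr0 addr0. Qed.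

Lemma vel0 a : vel a 0 = v 0 a.
Proof. by case: (db_init B) => _ h1 _ h2; rewrite /vel h1 h2 mulr1 mulr0 add0r. Qed.

Lemma pos0 a : pos a 0 = a.
Proof. by rewrite /pos disp0 subrK. Qed.

Section OneCurve.
Variable a : R.
Hypotheses (a0 : 0 < a) (hb : 0 < a - w 0 a) (hr : 0 < rho 0 a).

Let X := pos a.
Let b := a - w 0 a.
(** [X > 0] gives access to the radial equations, [rho > 0] allows division in the momentum
    equation, and [X - w > 0] allows [w] to be recovered from the enclosed mass. *)
Let good t := [/\ 0 < X t, 0 < X t - w t (X t) & 0 < rho t (X t)].

(* Gronwall for [g^2 + m^2], with [g] the velocity error and [m] the error in the
   enclosed mass [(X - w)^(n+1)]; the latter controls the error in [w] as long as
   [X - w > 0]. *)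
Lemma coincide_until tau : 0 <= tau -> (forall t, 0 <= t < tau -> good t) ->
  v tau (X tau) = vel a tau /\ (X tau - w tau (X tau)) ^+ n.+1 = b ^+ n.+1.
Proof.
move=> tau0 hg.
have cX := @pos_continuous a.
have cV := @vel_continuous a.
have [M hM] := rf_slab F tau.
pose P t := n.+1%:R * (X t ^+ n * rho (Num.max t 0) (X t)).
have cP : continuous P.
  move=> t; apply: cvgMr; apply: cvgM; last exact: (rf_rho_cont F cX).
  exact: (@continuous_expr _ X n cX t).
have [L hL] : exists L, forall t, 0 <= t <= tau -> P t <= L.
  have [|c _ h] := @EVT_max R P 0 tau tau0; first exact: continuous_subspaceT.
  by exists (P c) => t ht; apply: h; rewrite in_itv.
(* [N] converts the error [m] in the power into an error in [w]. *)
pose N := (b ^+ n)^-1.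
have N0 : 0 <= N by rewrite invr_ge0 exprn_ge0 ?(ltW hb).
(* [2 * M] absorbs the slope of [v], the term in [beta] the friction, the term in [kappa] the error
   in [w], and [L] the growth of the mass error. Dependence on the curve and on [tau] is harmless,
   as [y] starts at 0 and only its vanishing matters. *)
pose K := 2 * M + 2 * `|beta| + `|kappa| * N + L.
pose g t := v (Num.max t 0) (X t) - vel a t.
pose m t := (X t - w (Num.max t 0) (X t)) ^+ n.+1 - b ^+ n.+1.
pose y t := (g t ^+ 2 + m t ^+ 2) * expR (- K * t).
have cg : continuous g.
  by move=> t; apply: cvgB; [exact: (rf_v_cont F cX)|exact: cV].
have cm : continuous m.
  have ce : continuous (fun t => X t - w (Num.max t 0) (X t)).
    by move=> t; apply: cvgB; [exact: cX|exact: (rf_w_cont F cX)].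
  move=> t; apply: cvgB; last exact: cvg_cst.
  exact: (@continuous_expr _ _ n.+1 ce t).
have cy : continuous y.
  move=> t; apply: cvgM.
    by apply: cvgD; [exact: (@continuous_expr _ g 2 cg t)|exact: (@continuous_expr _ m 2 cm t)].
  apply: (continuous_comp (f := fun t => - K * t)); last exact: continuous_expR.
  by apply: cvgMr; exact: cvg_id.
have y00 : y 0 = 0.
  rewrite /y /g /m maxxx /X pos0 vel0 !subrr expr0n /= addr0 mul0r //.
have ydec : y tau <= y 0.
  pose h t := w t (X t) - disp a t.
  pose dg t := - g t * derive1 (v t) (X t) - kappa * h t - beta * g t.
  pose dm t := - P t * g t.
  apply: (@nonincreasing_is_derive R y (fun t =>
    (2 * g t * dg t + 2 * m t * dm t - K * (g t ^+ 2 + m t ^+ 2)) * expR (- K * t))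
    0 tau tau0 cy) => t /andP[t0 ttau].
    have t0' := ltW t0; have [X0 e0 r0] : good t by apply: hg; rewrite t0'.
    have hX : is_derive t 1 X (vel a t) by exact: pos_is_derive.
    have h1 : is_derive t 1 g (dg t).
      have hv := @clamp_is_derive R v X t _ t0 (rf_v_along F t0 hX).
      have hV := vel_is_derive a t.
      have := rf_momentum F t0 X0 => /eqP.
      rewrite mulf_eq0 (gt_eqF r0) /= => /eqP hmom.
      rewrite /g; derive_tac; rewrite /dg /g /h /= max_l//.
      move: hmom; set vt := derive1 _ t; set vr := derive1 _ _.
      move=> hmom; rewrite [vt](_ : _ = - (v t (X t) * vr + kappa * w t (X t) + beta * v t (X t))).
        by ring.
      by apply/eqP; rewrite -addr_eq0; apply/eqP; rewrite -hmom; ring.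
    have h2 : is_derive t 1 m (dm t).
      have hc := @clamp_is_derive R (fun s r => (r - w s r) ^+ n.+1) X t _ t0
        (cmass_along F t0 X0 hX).
      rewrite /m; derive_tac; rewrite /dm /P /g /= max_l//; ring.
    by rewrite /y; derive_tac; rewrite /=; ring.
  have t0' := ltW t0; have [X0 e0 r0] : good t by apply: hg; rewrite t0'.
  rewrite pmulr_lle0 ?expR_gt0// subr_le0.
  have ht : 0 <= t <= tau by rewrite t0' ltW.
  have hq := hM t (X t) ht X0.
  have hP : 0 <= P t <= L.
    by rewrite hL// andbT /P max_l// !mulr_ge0 ?exprn_ge0 ?(ltW X0) ?(ltW r0).
  have hh : `|h t| <= N * `|m t|.
    have := norm_subX_ge n (ltW e0) (ltW hb).
    rewrite -/b (_ : X t - w t (X t) - b = - h t); last by rewrite /X /pos /h /b; ring.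
    rewrite normrN -ler_pdivlMr ?exprn_gt0// mulrC.
    by rewrite /m max_l.
  rewrite /dg /dm; move: hq hP hh.
  move: (g t) (m t) (h t) (P t) (derive1 _ _) => G Y H Q q hq /andP[Q0 QL] hH.
  have A1 : - (q * G ^+ 2) <= M * G ^+ 2.
    by rewrite -mulNr ler_wpM2r ?sqr_ge0// (le_trans _ hq)// -normrN ler_norm.
  have A2 : - (beta * G ^+ 2) <= `|beta| * G ^+ 2.
    by rewrite -mulNr ler_wpM2r ?sqr_ge0// -normrN ler_norm.
  have gy : 2 * (`|G| * `|Y|) <= G ^+ 2 + Y ^+ 2.
    rewrite -(real_normK (num_real G)) -(real_normK (num_real Y)).
    by have := sqr_ge0 (`|G| - `|Y|); rewrite sqrrB; lra.
  have A3 : - (2 * kappa * G * H) <= `|kappa| * N * (G ^+ 2 + Y ^+ 2).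
    apply: (le_trans (ler_norm _)); rewrite normrN !normrM normr_nat.
    have k0 : 0 <= `|kappa| by [].
    apply: (@le_trans _ _ (`|kappa| * (2 * `|G| * (N * `|Y|)))).
      rewrite (_ : 2 * _ * _ * _ = `|kappa| * (2 * `|G| * `|H|)); last by ring.
      by rewrite !ler_wpM2l// mulr_ge0.
    rewrite -[`|kappa| * N * _]mulrA ler_wpM2l//.
    rewrite (_ : 2 * `|G| * _ = N * (2 * (`|G| * `|Y|))); last by ring.
    by rewrite ler_wpM2l.
  have A4 : - (2 * Q * G * Y) <= L * (G ^+ 2 + Y ^+ 2).
    apply: (le_trans (ler_norm _)); rewrite normrN !normrM normr_nat (ger0_norm Q0).
    rewrite (_ : 2 * Q * _ * _ = Q * (2 * (`|G| * `|Y|))); last by ring.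
    by apply: ler_pM => //; rewrite !mulr_ge0.
  have M0 : 0 <= M * Y ^+ 2.
    by rewrite mulr_ge0 ?sqr_ge0// (le_trans _ hq).
  have B0 : 0 <= `|beta| * Y ^+ 2 by rewrite mulr_ge0 ?sqr_ge0.
  rewrite /K; nra.
have : g tau ^+ 2 + m tau ^+ 2 <= 0.
  by move: ydec; rewrite y00 /y pmulr_lle0 ?expR_gt0.
rewrite le_eqVlt ltNge addr_ge0 ?sqr_ge0// orbF paddr_eq0 ?sqr_ge0// !sqrf_eq0.
rewrite /g /m max_l// => /andP[/eqP g0 /eqP m0].
by split; apply/eqP; rewrite -subr_eq0 ?g0 ?m0.
Qed.

(** Bootstrap on the minimum of the three quantities. Before [tau] the curve moves with velocity
    [v], which is at most [M X] in size because it vanishes at the origin; so [X] falls no faster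
    than [exp (- M t)]. The continuity equation bounds the fall of [rho] similarly, and [X - w]
    keeps its initial value. *)
Lemma curve_good t : 0 <= t -> good t.
Proof.
have cX := @pos_continuous a.
pose f t := Num.min (X t) (Num.min (X t - w (Num.max t 0) (X t)) (rho (Num.max t 0) (X t))).
have goodP s : 0 <= s -> 0 < f s -> good s.
  by move=> s0; rewrite /f max_l// !lt_min => /andP[h1 /andP[h2 h3]].
move=> t0; apply: (goodP t t0); move: t t0.
apply: positive_bootstrap.
- have cE : continuous (fun t => X t - w (Num.max t 0) (X t)).
    by move=> s; apply: cvgB; [exact: cX|exact: (rf_w_cont F cX)].
  move=> s; have cm := continuous_min (cE s) (rf_rho_cont F cX (x := s)).
  exact: (continuous_min (cX s) cm).
- by rewrite /f maxxx /X pos0 !lt_min a0 hb hr.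
move=> tau tau0 hf.
have hg s : 0 <= s < tau -> good s by move=> hs; apply: (goodP s); [case/andP: hs|exact: hf].
have [hv hw] := coincide_until (ltW tau0) hg.
have hvs s : 0 <= s < tau -> v s (X s) = vel a s.
  move=> /andP[s0 st]; have [x|//] := @coincide_until s s0.
  by move=> /andP[x0 xs]; apply: hg; rewrite x0 (lt_trans xs).
have [M hM] := rf_slab F tau.
have hvM : forall s, 0 <= s < tau -> `|v s (X s)| <= M * X s.
  move=> s /[dup] hs /andP[s0 st]; have [X0 _ _] := hg s hs.
  apply: (@norm_le_of_slope R (v s) (derive1 (v s))) => //.
  - exact: (rf_v0 F).
  - by move=> x; exact: (v_is_derive F).
  - by move=> x x0; apply: hM => //; rewrite s0 ltW.
have X0 : 0 < X tau.
  suff : - (X tau * expR (M * tau)) <= - (X 0 * expR (M * 0)).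
    rewrite lerN2 mulr0 expR0 mulr1 {1}/X pos0 => h.
    by have := lt_le_trans a0 h; rewrite pmulr_lgt0 ?expR_gt0.
  apply: (@nonincreasing_is_derive R (fun t => - (X t * expR (M * t)))
      (fun t => - (vel a t + M * X t) * expR (M * t)) 0 tau (ltW tau0)).
  - move=> s; apply: cvgN; apply: cvgM; first exact: cX.
    apply: (continuous_comp (f := fun t => M * t)); last exact: continuous_expR.
    by apply: cvgMr; exact: cvg_id.
  - move=> s hs; have hX : is_derive s 1 X (vel a s) by exact: pos_is_derive.
    by derive_tac; rewrite /=; ring.
  - move=> s /andP[s0 st]; have hs : 0 <= s < tau by rewrite ltW.
    rewrite pmulr_lle0 ?expR_gt0// oppr_le0.
    have := hvM s hs; rewrite hvs// ler_norml => /andP[]; lra.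
have r0 : 0 < rho tau (X tau).
  (* The divergence of the velocity is [v_r + n v / X], that is [n + 1] terms, each at most [M]. *)
  pose D := n.+1%:R * M.
  suff : - (rho (Num.max tau 0) (X tau) * expR (D * tau)) <= - (rho (Num.max 0 0) (X 0) * expR (D * 0)).
    rewrite lerN2 mulr0 expR0 mulr1 maxxx max_l ?(ltW tau0)// {1}/X pos0 => h.
    by have := lt_le_trans hr h; rewrite pmulr_lgt0 ?expR_gt0.
  apply: (@nonincreasing_is_derive R (fun t => - (rho (Num.max t 0) (X t) * expR (D * t)))
      (fun t => - (D - (derive1 (v t) (X t) + n%:R * (vel a t / X t))) * rho t (X t) * expR (D * t)) 0 tau (ltW tau0)).
  - move=> s; apply: cvgN; apply: cvgM; first exact: (rf_rho_cont F cX).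
    apply: (continuous_comp (f := fun t => D * t)); last exact: continuous_expR.
    by apply: cvgMr; exact: cvg_id.
  - move=> s /andP[s0 st]; have hs : 0 <= s < tau by rewrite ltW.
    have hX : is_derive s 1 X (vel a s) by exact: pos_is_derive.
    have hrho := @clamp_is_derive R rho X s _ s0 (rf_rho_along F s0 hX).
    have [Xs0 _ _] := hg s hs.
    have := rf_mass F s0 Xs0.
    rewrite hvs//; set rt := derive1 _ s; set rr := derive1 _ _; set vr := derive1 _ _.
    set z := vel a s / _.
    move=> hmass; derive_tac; rewrite /= (max_l (ltW s0)) -/rt -/rr.
    rewrite [rt](_ : _ = - (rr * vel a s + rho s (X s) * vr + n%:R * (rho s (X s) * z))).
      by ring.
    apply/eqP; rewrite -addr_eq0; apply/eqP; rewrite -hmass /z; ring.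
  - move=> s /andP[s0 st]; have hs : 0 <= s < tau by rewrite ltW.
    have [Xs0 _ rs0] := hg s hs.
    rewrite pmulr_lle0 ?expR_gt0// pmulr_lle0// oppr_le0 subr_ge0.
    rewrite (_ : D = M + n%:R * M); last by rewrite /D -natr1; ring.
    rewrite addrC [M + _]addrC lerD//.
      rewrite ler_wpM2l// ler_pdivrMr// -hvs//.
      exact: le_trans (ler_norm _) (hvM s hs).
    by apply: le_trans (ler_norm _) (hM s _ _ Xs0); rewrite !ltW.
(* Equality of powers leaves the sign of [X - w] open when [n.+1] is even; the limit from the left
   rules out a negative value. *)
have e0 : 0 < X tau - w tau (X tau).
  have : 0 <= X tau - w (Num.max tau 0) (X tau).
    apply: (@ge0_left_limit R (fun t => X t - w (Num.max t 0) (X t)) 0 tau tau0).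
      by apply: cvgB; [exact: cX|exact: (rf_w_cont F cX)].
    by move=> s /[dup] hs /andP[s0 _]; rewrite max_l//; have [] := hg s hs.
  rewrite max_l ?(ltW tau0)// => e0.
  have /eqP := hw; rewrite eqrXn2 ?(ltW hb)// => /eqP ->.
  exact: hb.
by rewrite /f max_l ?(ltW tau0)// !lt_min X0 e0 r0.
Qed.

Lemma along_curve t : 0 <= t ->
  [/\ good t, v t (X t) = vel a t & w t (X t) = disp a t].
Proof.
move=> t0; have hg s : 0 <= s < t -> good s by move=> /andP[s0 _]; exact: curve_good.
have [hv hw] := coincide_until t0 hg.
have [X0 e0 r0] := curve_good t0.
split=> //.
have /eqP := hw; rewrite eqrXn2 ?(ltW hb) ?(ltW e0)// => /eqP.
by rewrite /X /pos /b => h; lra.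
Qed.

End OneCurve.
End Characteristics.


(** * Dependence on the starting radius *)

Section Spread.
Context {R : realType} {n : nat} {kappa beta : R} {rho v w : R -> R -> R}.
Hypothesis F : radial_flow n kappa beta rho v w.
Context {y1 z1 y2 z2 : R -> R}.
Hypothesis B : damped_basis kappa beta y1 z1 y2 z2.
Variable c : R.
Hypotheses (c0 : 0 < c) (hc : forall r : R, 0 < r -> derive1 (w 0) r <= 1 - c).
Local Open Scope classical_set_scope.

Notation X := (@pos R v w y1 y2).
Notation W := (@disp R v w y1 y2).
Notation V := (@vel R v w z1 z2).

Lemma slope_gap (a : R) : 0 < a -> c <= 1 - derive1 (w 0) a.
Proof. by move=> /hc; rewrite lerBrDr addrC -lerBrDr. Qed.

(** The gap [c] integrates to [a - w 0 a >= c a], and with it the initial density is positive, so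
    every label [a > 0] starts a good curve. *)
Lemma along_char (a t : R) : 0 < a -> 0 <= t ->
  [/\ [/\ 0 < X a t, 0 < X a t - w t (X a t) & 0 < rho t (X a t)],
    v t (X a t) = V a t & w t (X a t) = W a t].
Proof.
move=> a0 t0.
have hb : c * a <= a - w 0 a.
  apply: (@ge_of_slope R (fun r => r - w 0 r) (fun r => 1 - derive1 (w 0) r)) => //.
  - by rewrite (rf_w0 F) // subr0.
  - move=> x; have h := w_is_derive F x (lexx 0).
    by derive_tac; rewrite /=; ring.
  - exact: slope_gap.
have hb0 : 0 < a - w 0 a by apply: lt_le_trans hb; rewrite mulr_gt0.
apply: (along_curve F B) => //.
rewrite (rf_density F) // mulr_gt0//; first exact: lt_le_trans (slope_gap a0).
by rewrite exprn_gt0// subr_gt0 ltr_pdivrMr// mul1r -subr_gt0.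
Qed.

(** The label derivatives [W_a], [V_a] and [X_a]. *)
Definition ddisp a t := derive1 (w 0) a * y1 t + derive1 (v 0) a * y2 t.
Definition dvel a t := derive1 (w 0) a * z1 t + derive1 (v 0) a * z2 t.
Definition dpos a t := 1 - derive1 (w 0) a + ddisp a t.

Lemma disp_is_derive_label (a t : R) : is_derive a 1 (fun x => W x t) (ddisp a t).
Proof.
have h1 := w_is_derive F a (lexx 0); have h2 := v_is_derive F a (lexx 0).
by rewrite /disp /ddisp; derive_tac; rewrite /=; ring.
Qed.

Lemma vel_is_derive_label (a t : R) : is_derive a 1 (fun x => V x t) (dvel a t).
Proof.
have h1 := w_is_derive F a (lexx 0); have h2 := v_is_derive F a (lexx 0).
by rewrite /vel /dvel; derive_tac; rewrite /=; ring.
Qed.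

Lemma pos_is_derive_label (a t : R) : is_derive a 1 (fun x => X x t) (dpos a t).
Proof.
have h1 := w_is_derive F a (lexx 0); have h2 := disp_is_derive_label a t.
by rewrite /pos /dpos; derive_tac; rewrite /=; ring.
Qed.

Lemma dpos_is_derive (a t : R) : is_derive t 1 (dpos a) (dvel a t).
Proof.
have h1 := db_y1 B t; have h2 := db_y2 B t.
by rewrite /dpos /ddisp /dvel; derive_tac; rewrite /=; ring.
Qed.

(* Differentiate the identities of [along_char] with respect to the label. *)
Lemma slope_along (a t : R) : 0 < a -> 0 <= t ->
  derive1 (w t) (X a t) * dpos a t = ddisp a t /\
  derive1 (v t) (X a t) * dpos a t = dvel a t.
Proof.
move=> a0 t0; split.
- have h := @is_derive_comp_fun _ (w t) (fun x => X x t) a _ _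
    (w_is_derive F (X a t) t0) (pos_is_derive_label a t).
  apply: (is_derive1_unique h); apply: near_eq_is_derive (disp_is_derive_label a t).
  near=> x; have [||_ _ ->//] := @along_char x t => //.
  by near: x; exact: lt_nbhsr.
- have h := @is_derive_comp_fun _ (v t) (fun x => X x t) a _ _
    (v_is_derive F (X a t) t0) (pos_is_derive_label a t).
  apply: (is_derive1_unique h); apply: near_eq_is_derive (vel_is_derive_label a t).
  near=> x; have [||_ -> //] := @along_char x t => //.
  by near: x; exact: lt_nbhsr.
Unshelve. all: by end_near. Qed.

(** From [w_r X_a = W_a] and the definition of [X_a], the product [(1 - w_r) X_a] is the initial
    slope gap, at least [c]; and [1 - w_r] is positive as a factor of the positive density. *)
Lemma dpos_gt0 (a t : R) : 0 < a -> 0 <= t -> 0 < dpos a t.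
Proof.
move=> a0 t0; have [[X0 e0 r0] _ _] := along_char a0 t0.
have [hw _] := slope_along a0 t0.
have h1 : 0 < 1 - derive1 (w t) (X a t).
  move: r0; rewrite (rf_density F)// pmulr_lgt0// exprn_gt0//.
  by rewrite subr_gt0 ltr_pdivrMr// mul1r -subr_gt0.
rewrite -(pmulr_rgt0 _ h1) mulrBl mul1r hw /dpos addrK.
exact: lt_le_trans (slope_gap a0).
Qed.

(** In time, [X_a] starts at 1 and has derivative [V_a = v_r X_a], so a bound on [v_r] limits its
    decay to an exponential independent of the label. *)
Lemma dpos_slab (T : R) : exists2 m, 0 < m &
  forall a t, 0 < a -> 0 <= t <= T -> m <= dpos a t.
Proof.
have [M hM] := rf_slab F T.
(* Absolute values, because neither [M] nor [T] comes with a sign. *)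
exists (expR (- `|M| * `|T|)); first exact: expR_gt0.
move=> a t a0 /andP[t0 tT].
have : - (dpos a t * expR (`|M| * t)) <= - (dpos a 0 * expR (`|M| * 0)).
  apply: (@nonincreasing_is_derive R (fun t => - (dpos a t * expR (`|M| * t)))
      (fun t => - (dvel a t + `|M| * dpos a t) * expR (`|M| * t)) 0 t t0).
  - move=> s; apply: cvgN; apply: cvgM.
      exact: (is_derive_continuous (dpos_is_derive a s)).
    apply: (continuous_comp (f := fun t => `|M| * t)); last exact: continuous_expR.
    by apply: cvgMr; exact: cvg_id.
  - move=> s hs; have h := dpos_is_derive a s.
    by derive_tac; rewrite /=; ring.
  - move=> s /andP[s0 st]; rewrite pmulr_lle0 ?expR_gt0// oppr_le0.
    have [_ <-] := slope_along a0 (ltW s0).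
    rewrite -mulrDl mulr_ge0 ?(ltW (dpos_gt0 a0 (ltW s0)))//.
    have [[X0 _ _] _ _] := along_char a0 (ltW s0).
    have := hM s (X a s); rewrite (ltW s0) (le_trans (ltW st) tT) X0 => /(_ isT isT).
    by rewrite ler_norml => /andP[]; have := ler_norm M; lra.
rewrite lerN2 mulr0 expR0 mulr1 => h.
have -> : dpos a t = dpos a t * expR (`|M| * t) * expR (- `|M| * t).
  by rewrite -mulrA -expRD mulNr subrr expR0 mulr1.
have d0 : dpos a 0 = 1.
  by rewrite /dpos /ddisp; case: (db_init B) => -> _ -> _; ring.
apply: (@le_trans _ _ (expR (- `|M| * t))).
  by rewrite ler_expR !mulNr lerN2 ler_wpM2l// (le_trans tT)// ler_norm.
by rewrite ler_peMl ?expR_ge0// -d0.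
Qed.

Lemma dpos_uniform (K g : R) : 0 < g ->
  (forall a t, 0 < a -> 0 <= t -> `|ddisp a t| <= K * expR (- g * t)) ->
  exists2 m, 0 < m & forall a t, 0 < a -> 0 <= t -> m <= dpos a t.
Proof.
move=> g0 hK.
have K0 : 0 <= K.
  have := hK 1 0 ltr01 (lexx _); rewrite mulr0 expR0 mulr1; exact: le_trans.
(* From [T] on, [K exp (- g t) <= c / 2], because [exp (g t) >= 1 + g t]; the gap [c] then leaves
   [c / 2] for [X_a]. *)
pose T := 2 * K / (c * g).
have T0 : 0 <= T by rewrite divr_ge0 ?mulr_ge0// ltW.
have [m m0 hm] := dpos_slab T.
exists (Num.min m (c / 2)); first by rewrite lt_min m0 divr_gt0.
move=> a t a0 t0; rewrite ge_min.
have [tT|Tt] := leP t T; first by rewrite hm ?t0.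
apply/orP; right.
have h1 : K * expR (- g * t) <= c / 2.
  rewrite mulNr expRN -[leLHS]/(K / _) ler_pdivrMr ?expR_gt0//.
  apply: (@le_trans _ _ (c / 2 * (1 + g * t))).
    have : K <= c / 2 * (g * t).
      rewrite (_ : K = c / 2 * (g * T)); last first.
        by rewrite /T; field; rewrite !gt_eqF.
      by rewrite !ler_wpM2l ?(ltW Tt)// ?divr_ge0 ?(ltW c0) ?(ltW g0).
    by move=> h; rewrite mulrDr (le_trans h)// mulr1 lerDr divr_ge0 ?(ltW c0).
  by rewrite ler_wpM2l ?expR_ge1Dx// divr_ge0// ltW.
have := le_trans (hK a t a0 t0) h1; rewrite ler_norml /dpos => /andP[h2 _].
by have := slope_gap a0; lra.
Qed.

(** [X] vanishes at label 0 and has slope at least [m], so the labels up to [r / m] already reach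
    [r]. This carries estimates along curves over to every radius. *)
Lemma pos_surjective (t m : R) : 0 <= t -> 0 < m ->
  (forall a, 0 < a -> m <= dpos a t) ->
  forall r, 0 < r -> exists2 a, 0 < a & X a t = r.
Proof.
move=> t0 m0 hm r r0.
have X00 : X 0 t = 0.
  by rewrite /pos /disp (rf_w0 F)// (rf_v0 F)// !mul0r subr0 !addr0.
have rm0 : 0 < r / m by rewrite divr_gt0.
have hX : r <= X (r / m) t.
  have := @ge_of_slope R (fun a => X a t) (dpos^~ t) m (r / m) X00
    (fun a => pos_is_derive_label a t) hm rm0.
  by rewrite mulrCA mulfV ?gt_eqF// mulr1.
have cX : {within `[0, r / m], continuous (fun a => X a t)}.
  apply: continuous_subspaceT => a.
  exact: (is_derive_continuous (pos_is_derive_label a t)).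
have [|a ha hXa] := @IVT R (fun a => X a t) 0 (r / m) r (ltW rm0) cX.
  by rewrite X00 min_l ?(le_trans (ltW r0))// max_r ?(le_trans (ltW r0))// (ltW r0).
exists a => //; move: ha; rewrite in_itv /= => /andP[a0 _].
rewrite lt_neqAle a0 andbT eq_sym; apply/eqP => a00.
by move: r0; rewrite -hXa a00 X00 ltxx.
Qed.

Lemma flow_bounds (t m D : R) : 0 <= t -> 0 < m ->
  (forall a, 0 < a -> m <= dpos a t) ->
  (forall a, 0 < a -> [/\ `|W a t| <= D, `|V a t| <= D,
     `|ddisp a t| <= D & `|dvel a t| <= D]) ->
  forall r, 0 < r -> [/\ `|w t r| <= D, `|v t r| <= D,
    `|derive1 (w t) r| <= D / m & `|derive1 (v t) r| <= D / m].
Proof.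
move=> t0 m0 hm hD r r0.
have [a a0 <-] := pos_surjective t0 m0 hm r0.
have [_ -> ->] := along_char a0 t0.
have [h1 h2 h3 h4] := hD a a0.
have [hw hv] := slope_along a0 t0.
have hs q : `|q * dpos a t| <= D -> `|q| <= D / m.
  rewrite normrM ler_pdivlMr// => hq; apply: le_trans hq.
  by rewrite ler_wpM2l// (le_trans (hm a a0))// ler_norm.
by split => //; apply: hs; rewrite ?hw ?hv.
Qed.

End Spread.


(** * Radial fields *)

Section Differentials.
Context {R : realType}.
Local Open Scope classical_set_scope.

Lemma within_continuous_along (T U V : topologicalType) (A : set U) (G : U -> V)
    (c : T -> U) (x : T) :
  {within A, continuous G} -> {for x, continuous c} -> A (c x) ->
  (\forall y \near x, A (c y)) -> {for x, continuous (fun y => G (c y))}.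
Proof.
move=> /subspace_continuousP hG hc Acx hA.
have hcA : c @ x --> within A (nbhs (c x)).
  move=> P hP; have := hc _ hP; rewrite /nbhs /= => h.
  by apply: filterS2 h hA => y /= h1 /h1.
by move=> P hP; exact: (hcA _ (hG _ Acx _ hP)).
Qed.

Lemma is_derive_differentiable (V : normedModType R) (c : R -> V) (t : R) (dc : V) :
  is_derive t 1 c dc -> differentiable c t /\ 'd c t 1 = dc.
Proof.
move=> hc; have dif_c : differentiable c t.
  by apply/derivable1_diffP; exact: ex_derive.
by split=> //; rewrite -deriveE// (@derive_val _ _ _ _ _ _ _ hc).
Qed.

Lemma is_derive_along (V : normedModType R) (f : V -> R) (c : R -> V) (t : R)
    (dc : V) : differentiable f (c t) -> is_derive t 1 c dc ->
  is_derive t 1 (fun s => f (c s)) ('d f (c t) dc).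
Proof.
move=> df hc.
have [dif_c dcE] := is_derive_differentiable hc.
have dif_fc : differentiable (fun s => f (c s)) t by exact: differentiable_comp.
apply: DeriveDef; first exact: diff_derivable.
by rewrite deriveE// (@diff_comp _ _ _ _ c f)//= dcE.
Qed.

Lemma line_is_derive (V : normedModType R) (v x : V) (t : R) :
  is_derive t 1 (fun s : R => s *: v + x) v.
Proof.
have h : is_derive t 1 (fun s : R => s *: v) v.
  apply: DeriveDef; first exact/diff_derivable/differentiableZl.
  rewrite deriveE; last exact: differentiableZl.
  by rewrite diffZl//= (is_derive_differentiable (is_derive_id t 1)).2 scale1r.
have := @is_deriveD R R^o V (fun s : R => s *: v) (cst x) t 1 v 0 h
  (@is_derive_cst R R^o V x t 1).
by rewrite addr0.
Qed.

Lemma derive_lineE (V : normedModType R) (f : V -> R) (x v : V) :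
  'D_v f x = derive1 (fun s : R => f (s *: v + x)) 0.
Proof.
have E : (fun h : R => h^-1 *: ((f \o shift x) (h *: v) - f x)) =
    (fun h : R => h^-1 *: (f ((h + 0) *: v + x) - f (0 *: v + x))).
  by apply/funext => h /=; rewrite addr0 scale0r add0r.
by rewrite /derive /derive1 E.
Qed.

Lemma derive_line_val (V : normedModType R) (f : V -> R) (x v : V) (d : R) :
  is_derive (0 : R) 1 (fun s : R => f (s *: v + x)) d -> 'D_v f x = d.
Proof. by move=> h; rewrite derive_lineE (derive1_val h). Qed.

Lemma jacobianE (p q : nat) (G : 'rV[R]_p -> 'rV[R]_q) x i j :
  differentiable G x -> ('J G x) i j = 'D_(delta_mx 0 i) (fun y => G y 0 j) x.
Proof.
move=> dG; have := deriveEjacobian (delta_mx 0 i) dG; rewrite -rowE => h.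
have := derive_mx (diff_derivable (v := delta_mx 0 i) dG).
by rewrite h => /matrixP /(_ 0 j); rewrite !mxE.
Qed.

Lemma differentiable_row (p : nat) (V : normedModType R) (G : V -> 'rV[R]_p) x :
  (forall i, differentiable (fun y => G y 0 i) x) -> differentiable G x.
Proof.
move=> h; rewrite (_ : G = \sum_i (fun y => G y 0 i *: delta_mx 0 i)).
  by apply: differentiable_sum => i; exact: differentiableZl.
by apply/funext => y; rewrite [LHS]row_sum_delta fct_sumE.
Qed.

Lemma differentiable_component (p : nat) (V : normedModType R)
    (G : V -> 'rV[R]_p) x i :
  differentiable G x -> differentiable (fun y => G y 0 i) x.
Proof.
move=> h.
exact: (@differentiable_comp _ _ _ _ G (fun N : 'rV[R]_p => N 0 i) x h
  (differentiable_coord _ _ _)).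
Qed.

End Differentials.

Section SpaceTime.
Context {R : realType} {V : normedModType R}.
Variables (f : R -> V -> R) (t : R) (x : V).
Hypothesis df : differentiable (fun q : R^o * V => f q.1 q.2) (t, x).

Lemma time_partial :
  is_derive t 1 (fun s => f s x) ('d (fun q : R^o * V => f q.1 q.2) (t, x) (1, 0)).
Proof.
apply: (@is_derive_along _ _ (fun q : R^o * V => f q.1 q.2) (fun s => (s, x))) => //.
have dp : differentiable (fun s : R^o => (s, x)) t.
  exact: differentiable_pair.
apply: DeriveDef; first exact: diff_derivable.
by rewrite deriveE// diff_pair//= (is_derive_differentiable (is_derive_id t 1)).2 diff_cst.
Qed.

Lemma space_partial (v : V) :
  'D_v (f t) x = 'd (fun q : R^o * V => f q.1 q.2) (t, x) (0, v).
Proof.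
apply: derive_line_val.
have := @is_derive_along _ _ (fun q : R^o * V => f q.1 q.2)
  (fun s : R => (t, s *: v + x)) 0 (0, v).
rewrite scale0r add0r; apply => //.
have hl := line_is_derive v x 0.
have [dl dlE] := is_derive_differentiable hl.
have dp : differentiable (fun s : R => (t : R^o, s *: v + x)) 0.
  exact: differentiable_pair.
apply: DeriveDef; first exact: diff_derivable.
by rewrite deriveE// diff_pair//= diff_cst dlE.
Qed.

End SpaceTime.

(** The space-time direction [(1, dX e)] splits as [(1, 0) + dX (0, e)], and the joint differential
    is linear. *)
Lemma along_ray (R : realType) (V : normedModType R) (f : R -> V -> R) (e : V)
    (X : R -> R) (t dX : R) :
  differentiable (fun q : R^o * V => f q.1 q.2) (t, X t *: e) ->
  is_derive t 1 X dX ->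
  is_derive t 1 (fun s => f s (X s *: e))
    (derive1 (fun s => f s (X t *: e)) t + dX * 'D_e (f t) (X t *: e)).
Proof.
move=> df hX; have [dX' dXE] := is_derive_differentiable hX.
have dZ : differentiable (fun s => X s *: e) t by exact: differentiableZl.
have dp : differentiable (fun s : R => (s : R^o, X s *: e)) t.
  exact: differentiable_pair.
have hp : is_derive t 1 (fun s : R => (s : R^o, X s *: e)) (1, dX *: e).
  apply: DeriveDef; first exact: diff_derivable.
  by rewrite deriveE// diff_pair//= (is_derive_differentiable (is_derive_id t 1)).2 diffZl// dXE.
have h := @is_derive_along _ _ (fun q : R^o * V => f q.1 q.2) _ t _ df hp.
apply: (is_derive_eq h).
rewrite (_ : (1, dX *: e) = (1, 0) + dX *: (0, e) :> R^o * V); last first.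
  by congr pair => /=; rewrite ?scaler0 ?addr0 ?add0r.
by rewrite linearD linearZ /= (derive1_val (time_partial df)) (space_partial df).
Qed.


(** * Polar form of gradients and Jacobians *)

Section Radial.
Context {R : realType} {n : nat}.
Local Open Scope classical_set_scope.
Notation e1 := (delta_mx 0 0 : 'rV[R]_n.+1).

Lemma enorm_ge0 (x : 'rV[R]_n.+1) : 0 <= enorm x.
Proof. exact: sqrtr_ge0. Qed.

Lemma sqr_enorm (x : 'rV[R]_n.+1) : enorm x ^+ 2 = \sum_i x 0 i ^+ 2.
Proof. by rewrite sqr_sqrtr// sumr_ge0// => i _; exact: sqr_ge0. Qed.

Lemma ray_entry (r : R) i : (r *: e1) 0 i = r * (i == 0)%:R.
Proof. by rewrite !mxE eqxx. Qed.

Lemma enorm_ray (r : R) : enorm (r *: e1) = `|r|.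
Proof.
rewrite /enorm (bigD1 0)//= ray_entry eqxx mulr1 big1 ?addr0 ?sqrtr_sqr//.
by move=> i /negPf i0; rewrite ray_entry i0 mulr0 expr0n.
Qed.

Lemma entry_le_enorm (x : 'rV[R]_n.+1) i : `|x 0 i| <= enorm x.
Proof.
rewrite -ler_sqr ?nnegrE ?enorm_ge0// sqr_enorm real_normK ?num_real//.
by rewrite (bigD1 i)//= lerDl sumr_ge0// => j _; exact: sqr_ge0.
Qed.

Lemma enorm_eq0 (x : 'rV[R]_n.+1) : enorm x = 0 -> x = 0.
Proof.
move=> h; apply/rowP => i; rewrite mxE; apply/eqP; rewrite -normr_le0 -h.
exact: entry_le_enorm.
Qed.

Lemma enorm_line_is_derive (x : 'rV[R]_n.+1) i : 0 < enorm x ->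
  is_derive (0 : R) 1 (fun s => enorm (s *: delta_mx 0 i + x)) (x 0 i / enorm x).
Proof.
move=> x0.
have E (s : R) : enorm (s *: delta_mx 0 i + x) =
    Num.sqrt (enorm x ^+ 2 + 2 * x 0 i * s + s ^+ 2).
  congr Num.sqrt; rewrite sqr_enorm (bigD1 i)//= [in RHS](bigD1 i)//= !mxE !eqxx.
  rewrite (eq_bigr (fun j => x 0 j ^+ 2)); last first.
    by move=> j /negPf ji; rewrite !mxE eqxx ji mulr0 add0r.
  by rewrite mulr1; ring.
rewrite (_ : (fun s => _) =
  fun s => Num.sqrt (enorm x ^+ 2 + 2 * x 0 i * s + s ^+ 2)); last exact/funext.
have hq : is_derive (0 : R) 1 (fun s => enorm x ^+ 2 + 2 * x 0 i * s + s ^+ 2)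
    (2 * x 0 i).
  by derive_tac; rewrite /=; ring.
have h0 : 0 < enorm x ^+ 2 + 2 * x 0 i * 0 + 0 ^+ 2.
  by rewrite mulr0 expr0n /= !addr0 exprn_gt0.
have := @is_derive_comp_fun _ Num.sqrt
  (fun s => enorm x ^+ 2 + 2 * x 0 i * s + s ^+ 2) 0 _ _ (is_derive1_sqrt h0) hq.
move=> h; apply: (is_derive_eq h).
rewrite mulr0 expr0n /= !addr0 sqrtr_sqr ger0_norm ?enorm_ge0//.
by field; rewrite gt_eqF.
Qed.

Lemma derive1_profile (f : 'rV[R]_n.+1 -> R) (r : R) :
  derive1 (profile f) r = 'D_e1 f (r *: e1).
Proof.
have E : (fun h : R => h^-1 *: ((f \o shift (r *: e1)) (h *: e1) - f (r *: e1))) =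
    (fun h : R => h^-1 *: (profile f (h + r) - profile f r)).
  by apply/funext => h /=; rewrite /profile scalerDl.
by rewrite /derive /derive1 E.
Qed.

Lemma profile_is_derive (f : 'rV[R]_n.+1 -> R) (r : R) :
  differentiable f (r *: e1) -> is_derive r 1 (profile f) ('D_e1 f (r *: e1)).
Proof.
move=> df; rewrite -derive1_profile; apply: derivable1_derive1.
apply/derivable1_diffP; rewrite /profile.
by apply: (@differentiable_comp _ _ _ _ (fun r : R => r *: e1) f) => //; exact: differentiableZl.
Qed.

Lemma vprofile_is_derive (F : 'rV[R]_n.+1 -> 'rV[R]_n.+1) (r : R) :
  differentiable F (r *: e1) -> is_derive r 1 (vprofile F) ('J F (r *: e1) 0 0).
Proof.
move=> dF; rewrite jacobianE//; apply: profile_is_derive.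
exact: differentiable_component.
Qed.

Lemma vprofile_grad (f : 'rV[R]_n.+1 -> R) : vprofile (grad f) = derive1 (profile f).
Proof. by apply/funext => r; rewrite /vprofile mxE derive1_profile. Qed.

Lemma vradial0 (F : 'rV[R]_n.+1 -> 'rV[R]_n.+1) : vradial F -> F 0 = 0.
Proof. by move=> ->; rewrite scaler0. Qed.

Lemma vprofile0 (F : 'rV[R]_n.+1 -> 'rV[R]_n.+1) : vradial F -> vprofile F 0 = 0.
Proof. by move=> h; rewrite /vprofile scale0r vradial0// mxE. Qed.

Lemma vradial_entry (F : 'rV[R]_n.+1 -> 'rV[R]_n.+1) x i : vradial F ->
  F x 0 i = vprofile F (enorm x) / enorm x * x 0 i.
Proof. by move=> ->; rewrite mxE. Qed.

(** The Jacobian acts as [d] in the radial direction and as the quotient of profile by radius on its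
    orthogonal complement; [x_i x_j / r^2] is the radial projection. *)
Lemma vradial_jacobian (F : 'rV[R]_n.+1 -> 'rV[R]_n.+1) x i j (d : R) :
  vradial F -> differentiable F x -> 0 < enorm x ->
  is_derive (enorm x) 1 (vprofile F) d ->
  'J F x i j = (d - vprofile F (enorm x) / enorm x) * (x 0 i * x 0 j / enorm x ^+ 2) +
    vprofile F (enorm x) / enorm x * (i == j)%:R.
Proof.
move=> hF dF x0 hd; rewrite jacobianE//; apply: derive_line_val.
have hr := enorm_line_is_derive i x0.
have hd' : is_derive (enorm (0 *: delta_mx 0 i + x)) 1 (vprofile F) d.
  by rewrite scale0r add0r.
have hf := @is_derive_comp_fun _ (vprofile F)
  (fun s => enorm (s *: delta_mx 0 i + x)) 0 _ _ hd' hr.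
have hV : is_derive (0 : R) 1 (fun s => (enorm (s *: delta_mx 0 i + x))^-1)
   (- (enorm x) ^- 2 * (x 0 i / enorm x)).
  have := @is_deriveV R (fun s => enorm (s *: delta_mx 0 i + x)) 0 _ 1 _ hr.
  by rewrite scale0r add0r; apply; rewrite gt_eqF.
have -> : (fun s : R => F (s *: delta_mx 0 i + x) 0 j) = (fun s =>
    vprofile F (enorm (s *: delta_mx 0 i + x)) * (enorm (s *: delta_mx 0 i + x))^-1 *
    (s * (i == j)%:R + x 0 j)).
  by apply/funext => s; rewrite vradial_entry// !mxE eqxx [j == i]eq_sym.
derive_tac; rewrite /= !scale0r !add0r.
by field; rewrite gt_eqF.
Qed.

(** On the first axis the radial projection is a diagonal matrix unit, so trace and determinant can
    be read off. *)
Lemma vradial_jacobian_ray (F : 'rV[R]_n.+1 -> 'rV[R]_n.+1) (r d : R) i j :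
  vradial F -> differentiable F (r *: e1) -> 0 < r ->
  is_derive r 1 (vprofile F) d ->
  'J F (r *: e1) i j = (i == j)%:R * (if i == 0 then d else vprofile F r / r).
Proof.
move=> hF dF r0 hd.
have er : enorm (r *: e1) = r by rewrite enorm_ray gtr0_norm.
have er0 : 0 < enorm (r *: e1) by rewrite er.
have hd' : is_derive (enorm (r *: e1)) 1 (vprofile F) d by rewrite er.
rewrite (vradial_jacobian i j hF dF er0 hd') er !ray_entry.
have rn : r != 0 by rewrite gt_eqF.
have [->|i0] := eqVneq i 0; last by rewrite !mulr0 !mul0r mulr0 add0r mulrC.
rewrite [0 == j]eq_sym; case: (j == 0); rewrite /= ?mulr0n ?mulr1n; by field.
Qed.

Lemma vradial_divergence_ray (F : 'rV[R]_n.+1 -> 'rV[R]_n.+1) (r d : R) :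
  vradial F -> differentiable F (r *: e1) -> 0 < r ->
  is_derive r 1 (vprofile F) d ->
  divergence F (r *: e1) = d + n%:R * (vprofile F r / r).
Proof.
move=> hF dF r0 hd; rewrite /divergence /mxtrace.
rewrite big_ord_recl (vradial_jacobian_ray _ _ hF dF r0 hd) eqxx mul1r; congr (_ + _).
rewrite (eq_bigr (fun=> vprofile F r / r)) ?sumr_const ?card_ord ?mulr_natl//.
by move=> i _; rewrite (vradial_jacobian_ray _ _ hF dF r0 hd) eqxx mul1r.
Qed.

Lemma vradial_grad (f : 'rV[R]_n.+1 -> R) : radial f ->
  (forall x, differentiable f x) -> vradial (grad f).
Proof.
move=> hf df x; apply/rowP => i; rewrite !mxE vprofile_grad derive1_profile.
apply: derive_line_val.
have := enorm_ge0 x; rewrite le_eqVlt => /predU1P[/esym x0|x0].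
  rewrite (enorm_eq0 x0) mxE mulr0.
  set g := fun s : R => _.
  have hg : is_derive (0 : R) 1 g ('D_(delta_mx 0 i) f 0).
    rewrite /g derive_lineE; apply: derivable1_derive1.
    exact: (derivable1P _ _ _).1 (diff_derivable (df 0)).
  (* Radial symmetry makes [g] even, so its derivative at 0 equals its own opposite. *)
  have geven s : g (- s) = g s.
    rewrite /g !addr0 hf [RHS]hf; congr profile; congr Num.sqrt.
    by apply: eq_bigr => j _; rewrite !mxE mulNr sqrrN.
  have hn : is_derive (0 : R) 1 (fun s : R => g (- s)) (- 'D_(delta_mx 0 i) f 0).
    have hg' : is_derive (- 0 : R) 1 g ('D_(delta_mx 0 i) f 0) by rewrite oppr0.
    have hid : is_derive (0 : R) 1 (fun s : R => - s) (-1) by derive_tac.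
    by apply: (is_derive_eq (@is_derive_comp_fun _ g (fun s => - s) 0 _ _ hg' hid)); rewrite mulrN1.
  rewrite (_ : (fun s => g (- s)) = g) in hn; last exact/funext.
  apply: (is_derive_eq hg).
  by have := is_derive1_unique hg hn; lra.
rewrite (_ : (fun s : R => _) =
  fun s => profile f (enorm (s *: delta_mx 0 i + x))); last first.
  by apply/funext => s; exact: hf.
have hr := enorm_line_is_derive i x0.
have hp : is_derive (enorm (0 *: delta_mx 0 i + x)) 1 (profile f)
   ('D_e1 f (enorm x *: e1)).
  by rewrite scale0r add0r; exact: profile_is_derive.
apply: (is_derive_eq (@is_derive_comp_fun _ (profile f)
  (fun s => enorm (s *: delta_mx 0 i + x)) 0 _ _ hp hr)).
by rewrite mulrCA mulrC.
Qed.

Lemma det_sub_hessian_ray (f : 'rV[R]_n.+1 -> R) (r : R) : radial f ->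
  (forall x, differentiable f x) -> (forall x, differentiable (grad f) x) ->
  0 < r -> let w := derive1 (profile f) in
  \det (1%:M - hessian f (r *: e1)) = (1 - derive1 w r) * (1 - w r / r) ^+ n.
Proof.
move=> hf df dgf r0 w.
have hw : is_derive r 1 (vprofile (grad f)) (derive1 w r).
  have h := vprofile_is_derive (dgf (r *: e1)).
  by apply: (is_derive_eq h); rewrite -(derive1_val h) vprofile_grad.
rewrite (_ : _ - _ = diag_mx (\row_(i < n.+1) if i == 0 then 1 - derive1 w r else 1 - w r / r)).
  rewrite det_diag big_ord_recl mxE eqxx; congr (_ * _).
  rewrite (eq_bigr (fun=> 1 - w r / r)) ?prodr_const ?card_ord//.
  by move=> i _; rewrite mxE.
apply/matrixP => i j.
have -> : (1%:M - hessian f (r *: e1)) i j = (i == j)%:R - 'J (grad f) (r *: e1) i j.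
  by rewrite !mxE.
rewrite (vradial_jacobian_ray i j (vradial_grad hf df) (dgf _) r0 hw).
rewrite vprofile_grad -/w !mxE.
have [ij|ij] := eqVneq i j; last by rewrite mulr0n mul0r subr0.
by rewrite mul1r mulr1n; case: (i == 0).
Qed.

End Radial.


(** * From the solution in space to the radial flow *)

Section Reduction.
Context {R : realType} {n : nat} {kappa beta : R}.
Context {rho : R -> 'rV[R]_n.+1 -> R} {u : R -> 'rV[R]_n.+1 -> 'rV[R]_n.+1}
  {phi : R -> 'rV[R]_n.+1 -> R}.
Hypothesis S : global_radial_solution kappa beta rho u phi.
Local Open Scope classical_set_scope.
Notation e1 := (delta_mx 0 0 : 'rV[R]_n.+1).
Notation r_ := (fun t => profile (rho t)).
Notation v_ := (fun t => vprofile (u t)).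
Notation w_ := (fun t => derive1 (profile (phi t))).

Lemma ray_continuous (X : R -> R) : continuous X ->
  continuous (fun t : R => (Num.max t 0, X t *: e1)).
Proof.
move=> cX t; apply: (@cvg_pair _ _ _ _ (nbhs (Num.max t 0)) (nbhs (X t *: e1))).
  have c0 : {for t, continuous (cst (0 : R))} by exact: cst_continuous.
  have cid : {for t, continuous (@id R)} by exact: cvg_id.
  exact: (continuous_max cid c0).
exact: (continuous_comp (cX t) (@scalel_continuous _ _ e1 (X t))).
Qed.

Lemma ray_continuous_comp (V : normedModType R) (f : R * 'rV[R]_n.+1 -> V)
    (X : R -> R) :
  {within [set p : R * 'rV[R]_n.+1 | 0 <= p.1], continuous f} -> continuous X ->
  continuous (fun t : R => f (Num.max t 0, X t *: e1)).
Proof.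
move=> cf cX t.
apply: (within_continuous_along cf (ray_continuous cX (x := t))) => /=.
  by rewrite le_max lexx orbT.
by apply: (@filterE _ (nbhs t)) => s /=; rewrite le_max lexx orbT.
Qed.

Lemma entry_continuous (T : topologicalType) (f : T -> 'rV[R]_n.+1) i :
  continuous f -> continuous (fun x => f x 0 i).
Proof.
move=> cf x; exact: (continuous_comp (cf x) (@coord_continuous _ _ _ _ _ _)).
Qed.

Lemma solution_density (t r : R) : 0 <= t -> 0 < r ->
  profile (rho t) r = (1 - derive1 (w_ t) r) * (1 - w_ t r / r) ^+ n.
Proof.
move=> t0 r0; rewrite /profile -(monge_ampere_eq S)//.
apply: (det_sub_hessian_ray (phi_radial S t0)) => // x.
  exact: (C2_diff (phi_C2 S)).
exact: (C2_grad_diff (phi_C2 S)).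
Qed.

Lemma flux_vradial t : 0 <= t -> vradial (fun x => rho t x *: u t x).
Proof.
move=> t0 x; rewrite [in LHS](rho_radial S t0) [in LHS](u_radial S t0) scalerA.
by rewrite /vprofile !mxE; congr (_ *: _); rewrite mulrA.
Qed.

Lemma flux_differentiable t x : 0 <= t -> differentiable (fun x => rho t x *: u t x) x.
Proof.
move=> t0; apply: differentiable_row => i.
rewrite (_ : (fun y => _) = (fun y => rho t y * u t y 0 i)); last first.
  by apply/funext => y; rewrite mxE.
apply: differentiableM; first exact: (C1_space (rho_C1 S)).
by apply: differentiable_component; exact: (C1_space (u_C1 S)).
Qed.

Lemma rho_profile_is_derive (t r : R) : 0 <= t ->
  is_derive r 1 (r_ t) (derive1 (r_ t) r).
Proof.
move=> t0; have h := profile_is_derive (C1_space (rho_C1 S) (r *: e1) t0).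
by apply: (is_derive_eq h); rewrite (derive1_val h).
Qed.

Lemma u_profile_is_derive (t r : R) : 0 <= t ->
  is_derive r 1 (v_ t) (derive1 (v_ t) r).
Proof.
move=> t0; have h := vprofile_is_derive (C1_space (u_C1 S) (r *: e1) t0).
by apply: (is_derive_eq h); rewrite (derive1_val h).
Qed.

Lemma flux_divergence (t r : R) : 0 <= t -> 0 < r ->
  divergence (fun y => rho t y *: u t y) (r *: e1) =
  (derive1 (r_ t) r * v_ t r + r_ t r * derive1 (v_ t) r) + n%:R * (r_ t r * v_ t r / r).
Proof.
move=> t0 r0.
have E : vprofile (fun y => rho t y *: u t y) = fun r => r_ t r * v_ t r.
  by apply/funext => s; rewrite /vprofile /profile mxE.
have h1 := rho_profile_is_derive r t0; have h2 := u_profile_is_derive r t0.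
have h : is_derive r 1 (vprofile (fun y => rho t y *: u t y))
    (derive1 (r_ t) r * v_ t r + r_ t r * derive1 (v_ t) r).
  by rewrite E; derive_tac.
by rewrite (vradial_divergence_ray (flux_vradial t0) (flux_differentiable _ t0) r0 h) E.
Qed.

Lemma solution_mass (t r : R) : 0 < t -> 0 < r ->
  derive1 (fun s => r_ s r) t + (derive1 (r_ t) r * v_ t r +
    r_ t r * derive1 (v_ t) r) + n%:R * (r_ t r * v_ t r / r) = 0.
Proof.
move=> t0 r0; rewrite -addrA -flux_divergence ?(ltW t0)//.
exact: (mass_eq S).
Qed.

Lemma divergence_scale (k : 'rV[R]_n.+1 -> R) (F : 'rV[R]_n.+1 -> 'rV[R]_n.+1) x :
  differentiable k x -> differentiable F x ->
  divergence (fun y => k y *: F y) x =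
  k x * divergence F x + \sum_i F x 0 i * 'D_(delta_mx 0 i) k x.
Proof.
move=> dk dF.
have GE i : (fun y => (k y *: F y) 0 i) = k * (fun y => F y 0 i).
  by apply/funext => y; rewrite mxE.
have dFi i : differentiable (fun y => F y 0 i) x by exact: differentiable_component.
have dG : differentiable (fun y => k y *: F y) x.
  by apply: differentiable_row => i; rewrite GE; exact: differentiableM.
rewrite /divergence /mxtrace mulr_sumr -big_split /=; apply: eq_bigr => i _.
have hM := deriveM (v := delta_mx 0 i) (diff_derivable dk) (diff_derivable (dFi i)).
rewrite -GE in hM.
apply: (etrans (jacobianE i i dG)); apply: (etrans hM); congr (_ + _).
by congr (_ * _); apply: esym; exact: jacobianE.
Qed.

(** Grouping the flux as [u_1 (rho u)] exhibits the divergence of the mass flux, which the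
    continuity equation will cancel. *)
Lemma div_flux_ray (t r : R) : 0 <= t -> 0 < r ->
  div_flux (rho t) (u t) (r *: e1) 0 0 =
  v_ t r * divergence (fun y => rho t y *: u t y) (r *: e1) +
  r_ t r * v_ t r * derive1 (v_ t) r.
Proof.
move=> t0 r0; rewrite mxE.
have du := C1_space (u_C1 S) (r *: e1) t0.
have GE : (fun y => (rho t y * u t y 0 0) *: u t y) =
    (fun y => u t y 0 0 *: (rho t y *: u t y)).
  by apply/funext => y; rewrite scalerA mulrC.
rewrite GE (divergence_scale (differentiable_component _ du) (flux_differentiable _ t0)).
congr (_ + _).
rewrite (bigD1 0)//= big1 ?addr0; last first.
  move=> i /negPf i0; rewrite mxE (vradial_entry _ _ (u_radial S t0)) ray_entry i0.
  by rewrite !mulr0 mul0r.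
rewrite (derive1_val (vprofile_is_derive du)) (jacobianE _ _ du) mxE.
by [].
Qed.

Lemma joint_rho (t : R) x : 0 < t ->
  differentiable (fun q : R^o * 'rV[R]_n.+1 => rho q.1 q.2) (t, x).
Proof. by move=> t0; exact: (C1_joint (rho_C1 S)). Qed.

Lemma joint_u (t : R) x i : 0 < t ->
  differentiable (fun q : R^o * 'rV[R]_n.+1 => u q.1 q.2 0 i) (t, x).
Proof.
move=> t0.
apply: (@differentiable_component _ _ _ (fun q : R^o * 'rV[R]_n.+1 => u q.1 q.2)).
exact: (C1_joint (u_C1 S)).
Qed.

(** The time derivative of [rho u] and the flux contain [v] times the two terms of the continuity
    equation; these cancel and leave the transport form. The factor [rho] stays, its sign being
    settled only along good curves. *)
Lemma solution_momentum (t r : R) : 0 < t -> 0 < r ->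
  r_ t r * (derive1 (fun s => v_ s r) t + v_ t r * derive1 (v_ t) r +
    kappa * w_ t r + beta * v_ t r) = 0.
Proof.
move=> t0 r0; have t0' := ltW t0.
have := momentum_eq S (r *: e1) t0 => /matrixP /(_ 0 0).
have hr := time_partial (joint_rho (r *: e1) t0).
have hu i : is_derive t 1 (fun s => u s (r *: e1) 0 i)
    (derive1 (fun s => u s (r *: e1) 0 i) t).
  have h := @time_partial _ _ (fun s x => u s x 0 i) _ _ (joint_u (r *: e1) i t0).
  by apply: (is_derive_eq h); rewrite (derive1_val h).
have hprod i : derivable (fun s => (rho s (r *: e1) *: u s (r *: e1)) 0 i) t 1.
  rewrite (_ : (fun s => _) = (fun s => rho s (r *: e1) * u s (r *: e1) 0 i)); last first.
    by apply/funext => s; rewrite mxE.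
  have h := is_deriveM_fun hr (hu i).
  exact: (@ex_derive _ _ _ _ _ _ _ h).
have hd : derivable (fun s => rho s (r *: e1) *: u s (r *: e1)) t 1.
  by apply/derivable_mxP => i j; rewrite ord1.
rewrite [LHS]mxE div_flux_ray// derive1E derive_mx// mxE.
have hM := is_deriveM_fun hr (hu 0).
rewrite (_ : (fun s => (rho s (r *: e1) *: u s (r *: e1)) 0 0) =
  (fun s => rho s (r *: e1) * u s (r *: e1) 0 0)); last first.
  by apply/funext => s; rewrite mxE.
rewrite (@derive_val _ _ _ _ _ _ _ hM) -(derive1_val hr).
rewrite [RHS]mxE [X in _ = X + _]mxE [X in _ = - X + _]mxE [X in _ = _ + X]mxE.
rewrite [X in _ = _ - X]mxE -/(vprofile (grad (phi t)) r) vprofile_grad.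
rewrite -/(vprofile (u t) r).
have /eqP := mass_eq S (r *: e1) t0; rewrite addrC addr_eq0 => /eqP ->.
rewrite -/(profile (rho t) r).
rewrite /vprofile /profile => /eqP; rewrite -subr_eq0 => /eqP h.
rewrite -[RHS]h; ring.
Qed.
Lemma ray_slope_le (t M : R) : 0 <= t -> (Linfty (fun x => 'J (u t) x) <= M%:E)%E ->
  forall r, `|derive1 (v_ t) r| <= M.
Proof.
move=> t0 hM r; have du := C1_space (u_C1 S) (r *: e1) t0.
rewrite (derive1_val (vprofile_is_derive du)).
apply: (le_trans (mx_entry_le _ _ _)).
rewrite -lee_fin; apply: le_trans hM; apply: ereal_sup_ubound.
by exists (r *: e1).
Qed.

Lemma solution_flow : radial_flow n kappa beta r_ v_ w_.
Proof.
split.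
- move=> X cX; exact: (ray_continuous_comp (C1_cont (rho_C1 S)) cX).
- move=> X cX; apply: entry_continuous.
  exact: (ray_continuous_comp (C1_cont (u_C1 S)) cX).
- move=> X cX.
  rewrite (_ : (fun t => _) = (fun t => grad (phi (Num.max t 0)) (X t *: e1) 0 0)).
    apply: entry_continuous.
    exact: (ray_continuous_comp (C2_grad_cont (phi_C2 S)) cX).
  by apply/funext => t; rewrite -vprofile_grad.
- move=> t r t0; have h := rho_profile_is_derive r t0.
  exact: (@ex_derive _ _ _ _ _ _ _ h).
- move=> t r t0; have h := u_profile_is_derive r t0.
  exact: (@ex_derive _ _ _ _ _ _ _ h).
- move=> t r t0; rewrite -vprofile_grad.
  have h := vprofile_is_derive (C2_grad_diff (phi_C2 S) (r *: e1) t0).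
  exact: (@ex_derive _ _ _ _ _ _ _ h).
- by move=> t t0; exact: (vprofile0 (u_radial S t0)).
- move=> t t0; rewrite -vprofile_grad; apply: vprofile0.
  apply: (vradial_grad (phi_radial S t0)) => x.
  exact: (C2_diff (phi_C2 S)).
- move=> X t dX t0 hX; have h := along_ray (joint_rho (X t *: e1) t0) hX.
  by apply: (is_derive_eq h); rewrite derive1_profile.
- move=> X t dX t0 hX.
  have h := @along_ray _ _ (fun s x => u s x 0 0) _ _ _ _ (joint_u (X t *: e1) 0 t0) hX.
  by apply: (is_derive_eq h); rewrite -(derive1_profile (fun x => u t x 0 0)).
- move=> t r t0.
  have c : {for (t, r), continuous (fun p : R * R => (p.1, p.2 *: e1))}.
    apply: (@cvg_pair _ _ _ _ (nbhs t) (nbhs (r *: e1))); first exact: cvg_fst.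
    have c2 : {for (t, r), continuous (@snd R R)} by exact: cvg_snd.
    exact: (continuous_comp c2 (@scalel_continuous _ _ e1 r)).
  apply: (within_continuous_along (C1_time_cont (rho_C1 S)) c) => //=.
  have : (p.1 @[p --> (t, r)] --> t) by exact: cvg_fst.
  by move=> /(_ _ (lt_nbhsr t0)).
- exact: solution_mass.
- exact: solution_momentum.
- exact: solution_density.
- move=> T; have [M hM] := grad_u_bounded_on_slabs S T.
  exists M => t r /[dup] /andP[t0 _] ht r0; exact: (ray_slope_le t0 (hM t ht) r).
Qed.

End Reduction.


(** * Decay *)

Section Bounds.
Context {R : realType}.
Local Open Scope classical_set_scope.

(** A product of [n + 1] factors within [D] of 1 deviates from 1 linearly in [D] as long as [D] is
    bounded; [A] is chosen before [D], so an exponential rate in [D] is inherited. *)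
Lemma density_deviation (n : nat) (L : R) : 0 <= L -> exists2 A, 0 <= A &
  forall D p y : R, D <= L -> `|p| <= D -> `|y| <= D ->
    `|(1 - p) * (1 - y) ^+ n - 1| <= A * D.
Proof.
move=> L0; elim: n => [|n [A A0 IH]].
  exists 1 => // D p y _ hp _.
  by rewrite expr0 mulr1 addrAC subrr sub0r normrN mul1r.
exists (A * (1 + L) + 1); first by rewrite addr_ge0 ?mulr_ge0 ?addr_ge0.
move=> D p y DL hp hy; have := IH D p y DL hp hy.
set q := (1 - p) * _ => hq; rewrite exprSr mulrA -/q.
have D0 : 0 <= D by apply: le_trans hp.
rewrite (_ : q * (1 - y) - 1 = (q - 1) * (1 - y) - y); last by ring.
apply: (le_trans (ler_normB _ _)); rewrite [leRHS]mulrDl mul1r lerD// normrM mulrAC.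
apply: ler_pM => //; apply: (le_trans (ler_normB _ _)).
by rewrite normr1 lerD2l (le_trans hy).
Qed.

(** The radial estimates hold for positive radii; the origin inherits them by continuity. *)
Lemma norm_at0_le (f : R -> R) (K : R) : {for 0, continuous f} ->
  (forall s, 0 < s -> `|f s| <= K) -> `|f 0| <= K.
Proof.
move=> cf hK; rewrite leNgt; apply/negP => Kf.
have e0 : 0 < `|f 0| - K by rewrite subr_gt0.
have := cf => /cvgrPdist_lt /(_ _ e0) /nbhs_ballP[d /= d0 hd].
have d2 : 0 < d / 2 by rewrite divr_gt0.
have := hd (d / 2); rewrite /ball /= sub0r normrN gtr0_norm//.
rewrite ltr_pdivrMr// ltr_pMr// ltr1n => /(_ isT) h.
have := hK _ d2 => h2.
have := ler_normB (f 0 - f (d / 2)) (- f (d / 2)); rewrite opprK subrK normrN.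
lra.
Qed.

(** The difference quotient, completed by [d] at 0, is continuous there, so its bound on positive
    radii passes to [d]. *)
Lemma norm_derive_at0_le (f : R -> R) (d D : R) : f 0 = 0 ->
  is_derive (0 : R) 1 f d -> (forall s, 0 < s -> `|f s| <= D * s) -> `|d| <= D.
Proof.
move=> f0 hd hD.
pose g s := if s == 0 then d else f s / s.
have g0 : g 0 = d by rewrite /g eqxx.
rewrite -g0; apply: norm_at0_le.
  have /cvg_ex[l hl] : derivable f 0 1 by exact: ex_derive.
  have ld : l = d.
    by rewrite -(@derive_val _ _ _ _ _ _ _ hd) /derive; apply/esym/cvg_lim.
  apply/cvgrPdist_le => e e0; rewrite /= g0.
  have := hl => /cvgrPdist_le /(_ _ e0); rewrite /= near_withinE ld => hn.
  near=> s; rewrite /g; case: ifPn => [_|s0]; first by rewrite subrr normr0 ltW.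
  have : s != 0 -> `|d - s^-1 *: (f (s *: 1 + 0) - f 0)| <= e by near: s.
  move=> /(_ s0); rewrite f0 subr0 addr0 /GRing.scale /= mulr1.
  by rewrite [s^-1 * _]mulrC.
move=> s s0; rewrite /g gt_eqF// normrM normfV (gtr0_norm s0) ler_pdivrMr//.
exact: hD.
Unshelve. all: by end_near. Qed.

Lemma Linfty_le (d : nat) (V : normedModType R) (f : 'rV[R]_d -> V) (K : R) :
  (forall x, `|f x| <= K) -> (Linfty f <= K%:E)%E.
Proof. by move=> h; apply: ge_ereal_sup => _ [x _ <-]; rewrite lee_fin. Qed.

Lemma Linfty_bounded (d : nat) (V : normedModType R) (f : 'rV[R]_d -> V) :
  (Linfty f < +oo)%E -> exists K : R, forall x, `|f x| <= K.
Proof.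
have ub x : (`|f x|%:E <= Linfty f)%E by apply: ereal_sup_ubound; exists x.
move: ub; case: (Linfty f) => [K|//|] ub _; last by have := ub 0.
by exists K => x; rewrite -lee_fin.
Qed.

Lemma mx_norm_le (p q : nat) (A : 'M[R]_(p, q)) K : 0 <= K ->
  (forall i j, `|A i j| <= K) -> `|A| <= K.
Proof.
move=> K0 h; rewrite [leLHS]/Num.Def.normr /= mx_normrE.
by apply: bigmax_le => // -[i j] _; exact: h.
Qed.

End Bounds.

(** * From radial bounds to the state norm *)

Section StateNorm.
Context {R : realType} {n : nat} {kappa beta : R}.
Context {rho : R -> 'rV[R]_n.+1 -> R} {u : R -> 'rV[R]_n.+1 -> 'rV[R]_n.+1}
  {phi : R -> 'rV[R]_n.+1 -> R}.
Hypothesis S : global_radial_solution kappa beta rho u phi.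
Local Open Scope classical_set_scope.
Notation e1 := (delta_mx 0 0 : 'rV[R]_n.+1).
Notation r_ := (fun t => profile (rho t)).
Notation v_ := (fun t => vprofile (u t)).
Notation w_ := (fun t => derive1 (profile (phi t))).

(** [D] also bounds [v / r] and [w / r], as both profiles vanish at the origin. An entry of the
    velocity Jacobian is then at most [3 D]: [2 D] from the radial projection and [D] from the
    multiple of the identity. [A] accounts for the density. *)
Lemma state_norm_le (L A : R) : 0 <= A ->
  (forall D p y : R, D <= L -> `|p| <= D -> `|y| <= D ->
    `|(1 - p) * (1 - y) ^+ n - 1| <= A * D) ->
  forall t D, 0 <= t -> D <= L ->
  (forall r, 0 < r -> [/\ `|w_ t r| <= D, `|v_ t r| <= D,
     `|derive1 (w_ t) r| <= D & `|derive1 (v_ t) r| <= D]) ->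
  (state_norm (rho t) (u t) (phi t) <= ((A + 3) * D)%:E)%E.
Proof.
move=> A0 hA t D t0 DL hD; have F := solution_flow S.
have D0 : 0 <= D by have [h _ _ _] := hD 1 ltr01; exact: le_trans h.
have w0 := rf_w0 F t0; have v0 := rf_v0 F t0.
have wr r : 0 < r -> `|w_ t r| <= D * r.
  move=> r0; apply: (@norm_le_of_slope R (w_ t) (derive1 (w_ t)) D r w0 (fun x => w_is_derive F x t0)) => //.
  by move=> x /hD[].
have vr r : 0 < r -> `|v_ t r| <= D * r.
  move=> r0; apply: (@norm_le_of_slope R (v_ t) (derive1 (v_ t)) D r v0 (fun x => v_is_derive F x t0)) => //.
  by move=> x /hD[].
have quot (f : R -> R) r : 0 < r -> `|f r| <= D * r -> `|f r / r| <= D.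
  by move=> r0 hf; rewrite normrM normfV (gtr0_norm r0) ler_pdivrMr.
have D3 : D <= (A + 3) * D by rewrite ler_peMl//; lra.
have en x : x = 0 :> 'rV[R]_n.+1 \/ 0 < enorm x.
  have := enorm_ge0 x; rewrite le_eqVlt => /predU1P[/esym/enorm_eq0|]; by [left|right].
have en0 : enorm (0 : 'rV[R]_n.+1) = 0 by rewrite -(scale0r e1) enorm_ray normr0.
rewrite /state_norm !ge_max; apply/and5P; split; apply: Linfty_le => x.
- apply: (@le_trans _ _ (3 * D)); last by rewrite ler_wpM2r//; lra.
  apply: mx_norm_le => [|i j]; first by rewrite mulr_ge0.
  have du y : differentiable (u t) y by exact: (C1_space (u_C1 S)).
  have [->|x0] := en x.
    apply: (@le_trans _ _ D); last by lra.
    rewrite (jacobianE _ _ (du _)) derive_lineE.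
    apply: (@norm_derive_at0_le R (fun s => u t (s *: delta_mx 0 i + 0) 0 j)).
    + by rewrite scale0r addr0 (vradial0 (u_radial S t0)) mxE.
    + have h := diff_derivable (v := delta_mx 0 i) (differentiable_component j (du 0)).
      apply: derivable1_derive1.
      exact: (derivable1P _ _ _).1 h.
    + move=> s s0; have ens : enorm (s *: delta_mx 0 i : 'rV[R]_n.+1) = s.
        rewrite /enorm (bigD1 i)//= !mxE !eqxx mulr1 big1 ?addr0 ?sqrtr_sqr ?gtr0_norm//.
        by move=> k /negPf ki; rewrite !mxE ki andbF mulr0 expr0n.
      rewrite addr0 (vradial_entry _ _ (u_radial S t0)) ens !mxE eqxx /= mulrA divfK ?(gt_eqF s0)//.
      case: (j == i); rewrite /= ?mulr1n ?mulr0n ?mulr1 ?mulr0; first exact: vr.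
      by rewrite normr0 mulr_ge0 ?(ltW s0).
  have hd := v_is_derive F (enorm x) t0.
  rewrite (vradial_jacobian i j (u_radial S t0) (du x) x0 hd).
  have [_ _ _ h1] := hD _ x0; have h2 := quot _ _ x0 (vr _ x0).
  have h3 : `|x 0 i * x 0 j / enorm x ^+ 2| <= 1.
    rewrite normrM normfV normrX (gtr0_norm x0) ler_pdivrMr ?exprn_gt0// mul1r normrM expr2.
    by apply: ler_pM => //; exact: entry_le_enorm.
  have h4 : `|(i == j)%:R : R| <= 1 by case: (i == j); rewrite ?normr1 ?normr0.
  apply: (le_trans (ler_normD _ _)).
  rewrite [X in X + _]normrM [X in _ + X]normrM.
  rewrite (_ : 3 * D = (D + D) * 1 + D * 1); last by ring.
  apply: lerD; apply: ler_pM => //.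
  by apply: (le_trans (ler_normB _ _)); exact: lerD.
- apply: le_trans D3; apply: mx_norm_le => // i j; rewrite ord1.
  have [->|x0] := en x; first by rewrite (vradial0 (u_radial S t0)) mxE normr0.
  rewrite (vradial_entry _ _ (u_radial S t0)) -mulrA normrM.
  have [_ h _ _] := hD _ x0; rewrite -[D]mulr1; apply: ler_pM => //.
  rewrite normrM normfV (gtr0_norm x0) mulrC ler_pdivrMr// mul1r.
  exact: entry_le_enorm.
- apply: (@le_trans _ _ (A * D)); last by rewrite ler_wpM2r//; lra.
  have hpos r : 0 < r -> `|profile (rho t) r - 1| <= A * D.
    move=> r0; rewrite (rf_density F)//; have [_ _ h _] := hD _ r0.
    by apply: hA => //; exact: (quot _ _ r0 (wr _ r0)).
  rewrite (rho_radial S t0); have [->|x0] := en x; last exact: hpos.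
  rewrite en0; apply: (@norm_at0_le R (fun r => profile (rho t) r - 1)) => //.
  have h := rho_is_derive F 0 t0; apply: cvgB; last exact: cvg_cst.
  exact: is_derive_continuous h.
- apply: le_trans D3; have [->|x0] := en x; last by have [] := hD _ x0.
  rewrite en0; exact: (norm_derive_at0_le w0 (w_is_derive F 0 t0)).
- apply: le_trans D3; have [->|x0] := en x; last by have [] := hD _ x0.
  by rewrite en0 w0 normr0.
Qed.

Lemma initial_bounds : exists K : R, forall r, 0 < r ->
  [/\ `|w_ 0 r| <= K, `|v_ 0 r| <= K, `|derive1 (w_ 0) r| <= K &
      `|derive1 (v_ 0) r| <= K].
Proof.
have := initial_norm_finite S; rewrite /state_norm !gt_max.
move=> /and5P[h1 h2 _ h4 h5].
have [K1 hK1] := Linfty_bounded h1; have [K2 hK2] := Linfty_bounded h2.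
have [K4 hK4] := Linfty_bounded h4; have [K5 hK5] := Linfty_bounded h5.
pose K := Num.max (Num.max K1 K2) (Num.max K4 K5).
exists K => r r0; have er : enorm (r *: e1) = r by rewrite enorm_ray gtr0_norm.
split.
- by have := hK5 (r *: e1); rewrite er => h; rewrite !le_max h !orbT.
- apply: (le_trans (mx_entry_le _ _ _)).
  by have h := hK2 (r *: e1); rewrite !le_max h !orbT.
- by have := hK4 (r *: e1); rewrite er => h; rewrite !le_max h !orbT.
- have h := ray_slope_le S (lexx 0) (Linfty_le hK1) r.
  by rewrite !le_max h.
Qed.

End StateNorm.


Section Assembly.
Context {R : realType} {n : nat} {kappa beta : R}.
Local Open Scope classical_set_scope.

Lemma decays_at_rate_le (rho0 u0 phi0 : R -> R) (g1 g2 : R) : g1 <= g2 ->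
  decays_at_rate n kappa beta rho0 u0 phi0 g2 ->
  decays_at_rate n kappa beta rho0 u0 phi0 g1.
Proof.
move=> g12 [C C0 h]; exists C => // rho u phi S hi t t0.
apply: le_trans (h rho u phi S hi t t0) _; rewrite lee_fin ler_wpM2l ?(ltW C0)//.
by rewrite ler_expR !mulNr lerN2 ler_wpM2r.
Qed.

Lemma derive1_eq_pos (f g : R -> R) : (forall r, 0 < r -> f r = g r) ->
  forall r, 0 < r -> derive1 f r = derive1 g r.
Proof.
move=> fg r r0; rewrite !derive1E; apply: near_eq_derive.
by near=> s; apply: fg; near: s; exact: lt_nbhsr.
Unshelve. all: by end_near. Qed.

(** Profiles are prescribed for [r >= 0] while derivatives are two-sided, hence the restriction to
    positive radii. *)
Lemma initial_data rho u phi (rho0 u0 phi0 : R -> R) :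
  has_initial_profiles (n := n) rho u phi rho0 u0 phi0 -> forall r, 0 < r ->
  [/\ derive1 (profile phi) r = derive1 phi0 r, vprofile u r = u0 r,
    derive1 (derive1 (profile phi)) r = derive1 (derive1 phi0) r &
    derive1 (vprofile u) r = derive1 u0 r].
Proof.
move=> hi; have hu r : 0 < r -> vprofile u r = u0 r by move=> /ltW /hi[].
have hp : forall r, 0 < r -> derive1 (profile phi) r = derive1 phi0 r.
  by apply: derive1_eq_pos => r /ltW /hi[].
move=> r r0; split; [exact: hp|exact: hu|exact: (derive1_eq_pos hp)|].
exact: (derive1_eq_pos hu).
Qed.

(* [s = 0] imposes nothing on the data; [s = 1] selects the data whose modes
   [y'' + beta y' + kappa y = 0] are multiples of [exp (- lam t)]. *)
Lemma decay_of_modes (rho0 u0 phi0 y1 z1 y2 z2 : R -> R) (g s lam K : R) :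
  damped_basis kappa beta y1 z1 y2 z2 -> 0 < g -> 0 <= K ->
  nonvacuous phi0 ->
  (forall r, 0 < r -> s * (derive1 u0 r + lam * derive1 (derive1 phi0) r) = 0) ->
  (forall a b t, 0 <= t -> s * (b + lam * a) = 0 ->
    `|a * y1 t + b * y2 t| <= K * (`|a| + `|b|) * expR (- g * t) /\
    `|a * z1 t + b * z2 t| <= K * (`|a| + `|b|) * expR (- g * t)) ->
  decays_at_rate n kappa beta rho0 u0 phi0 g.
Proof.
move=> B g0 K0 [c c0 hc] hmode hK.
(* The lower bound on [X_a] is a property of the data alone, but it holds only
   because some solution exists; any one serves to obtain it. *)
have [[[[rho u] phi] [S hi]]|none] := pselect (exists p :
    (R -> 'rV[R]_n.+1 -> R) * (R -> 'rV[R]_n.+1 -> 'rV[R]_n.+1) *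
    (R -> 'rV[R]_n.+1 -> R),
    global_radial_solution kappa beta p.1.1 p.1.2 p.2 /\
    has_initial_profiles (p.1.1 0) (p.1.2 0) (p.2 0) rho0 u0 phi0); last first.
  exists 1 => // rho u phi S hi; exfalso; apply: none.
  by exists (rho, u, phi).
rewrite /= in S hi.
have hcS (phi' : R -> 'rV[R]_n.+1 -> R) rho' u' :
    has_initial_profiles rho' u' (phi' 0) rho0 u0 phi0 ->
    forall r : R, 0 < r -> derive1 (derive1 (profile (phi' 0))) r <= 1 - c.
  by move=> hi' r r0; have [_ _ -> _] := initial_data hi' r0; exact: hc.
have [K1 hK1] := initial_bounds S.
pose D := K * (K1 + K1).
have K10 : 0 <= K1 by have [h _ _ _] := hK1 1 ltr01; exact: le_trans h.
have bound a b t : 0 <= t -> s * (b + lam * a) = 0 -> `|a| <= K1 -> `|b| <= K1 ->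
    `|a * y1 t + b * y2 t| <= D * expR (- g * t) /\
    `|a * z1 t + b * z2 t| <= D * expR (- g * t).
  move=> t0 hab ha hb.
  have h : K * (`|a| + `|b|) * expR (- g * t) <= D * expR (- g * t).
    by rewrite ler_wpM2r ?expR_ge0// ler_wpM2l// lerD.
  by have [h1 h2] := hK a b t t0 hab; split; [exact: le_trans h1 h|exact: le_trans h2 h].
have D0 : 0 <= D by rewrite mulr_ge0 ?addr_ge0.
have slopes a t : 0 < a -> 0 <= t ->
    `|derive1 (derive1 phi0) a * y1 t + derive1 u0 a * y2 t| <= D * expR (- g * t) /\
    `|derive1 (derive1 phi0) a * z1 t + derive1 u0 a * z2 t| <= D * expR (- g * t).
  move=> a0 t0; apply: bound => //; first exact: hmode.
    by have [_ _ h _] := hK1 a a0; have [_ _ <- _] := initial_data hi a0.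
  by have [_ _ _ h] := hK1 a a0; have [_ _ _ <-] := initial_data hi a0.
have hK1' a : 0 < a -> `|derive1 phi0 a| <= K1 /\ `|u0 a| <= K1.
  by move=> a0; have [h1 h2 _ _] := hK1 a a0; have [<- <- _ _] := initial_data hi a0.
(* The relation is given for the slopes; it integrates to the profiles because both vanish at the
   origin. *)
have modes_rel a : 0 < a -> s * (u0 a + lam * derive1 phi0 a) = 0.
  move=> a0; have F := solution_flow S.
  have [<- <- _ _] := initial_data hi a0.
  pose q r := s * (vprofile (u 0) r + lam * derive1 (profile (phi 0)) r).
  pose dq r := s * (derive1 (vprofile (u 0)) r + lam * derive1 (derive1 (profile (phi 0))) r).
  have q0 : q 0 = 0 by rewrite /q (rf_v0 F)// (rf_w0 F)// mulr0 addr0 mulr0.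
  have hq (x : R) : is_derive x 1 q (dq x).
    have h1 := v_is_derive F x (lexx 0); have h2 := w_is_derive F x (lexx 0).
    by rewrite /q; derive_tac; rewrite /dq /=; ring.
  have hdq x : 0 < x -> `|dq x| <= 0.
    move=> x0; rewrite /dq; have [_ _ -> ->] := initial_data hi x0.
    by rewrite hmode// normr0.
  have := norm_le_of_slope q0 hq hdq a0; rewrite mul0r normr_le0 => /eqP.
  exact.
have [m m0 hm] : exists2 m, 0 < m & forall a t, 0 < a -> 0 <= t ->
    m <= 1 - derive1 (derive1 phi0) a +
      (derive1 (derive1 phi0) a * y1 t + derive1 u0 a * y2 t).
  have F := solution_flow S.
  have [|m m0 hm] := @dpos_uniform R n kappa beta _ _ _ F y1 z1 y2 z2 B c c0
    (hcS _ _ _ hi) D g g0.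
    move=> a t a0 t0; rewrite /ddisp.
    have [_ _ -> ->] := initial_data hi a0.
    by have [] := slopes a t a0 t0.
  exists m => // a t a0 t0; have := hm a t a0 t0; rewrite /dpos /ddisp.
  by have [_ _ -> ->] := initial_data hi a0.
(* One constant for the values, bounded by [D], and for the slopes, which lose [1 / m] on division
   by [X_a]. *)
pose E := D * (1 + m^-1).
have E0 : 0 <= E by rewrite mulr_ge0 ?addr_ge0 ?invr_ge0 ?(ltW m0).
have [A A0 hA] := density_deviation n E0.
pose C := (A + 3) * E + 1.
have AE0 : 0 <= (A + 3) * E by rewrite mulr_ge0 ?addr_ge0.
exists C; first by rewrite ltr_wpDl.
(* The auxiliary solution is discarded; the facts kept about the constants are phrased through [u0]
   and [phi0], so they apply to any solution with these profiles. *)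
move=> {S hi hK1 rho u phi} rho u phi S hi t t0.
have F := solution_flow S.
have hcS' := hcS _ _ _ hi.
pose e := expR (- g * t).
have e1 : e <= 1 by rewrite -expR0 ler_expR mulNr oppr_le0 mulr_ge0// ltW.
have e0 : 0 <= e by exact: expR_ge0.
have fb := @flow_bounds R n kappa beta _ _ _ F y1 z1 y2 z2 B c c0 hcS' t m (D * e) t0 m0 _ _.
have DE : D * e <= E * e.
  by rewrite ler_wpM2r// /E mulrDr mulr1 lerDl mulr_ge0// invr_ge0 ltW.
have DmE : D * e / m <= E * e.
  by rewrite mulrAC ler_wpM2r// /E mulrDr mulr1 lerDr.
apply: (@le_trans _ _ ((A + 3) * (E * e))%:E); last first.
  by rewrite lee_fin mulrA ler_wpM2r// lerDl.
apply: (state_norm_le S A0 hA t0) => [|r r0]; first by rewrite ler_piMr.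
have [||h1 h2 h3 h4] := fb _ _ r r0.
- move=> a a0; rewrite /dpos /ddisp.
  by have [_ _ -> ->] := initial_data hi a0; exact: hm.
- move=> a a0; rewrite /disp /vel /ddisp /dvel.
  have rel := modes_rel a a0.
  have [-> -> -> ->] := initial_data hi a0.
  have [h3 h4] := slopes a t a0 t0.
  have [h1 h2] := bound (derive1 phi0 a) (u0 a) t t0 rel (hK1' a a0).1 (hK1' a a0).2.
  by split.
by split; [exact: le_trans h1 DE|exact: le_trans h2 DE|exact: le_trans h3 DmE|
  exact: le_trans h4 DmE].
Qed.
End Assembly.


(** * Explicit solutions of the damped oscillator *)

Section Bases.
Context {R : realType}.
Implicit Types (a b t kappa beta alpha omega : R).

Lemma mode_bound (y1 y2 C e a b : R) : `|y1| <= C * e -> `|y2| <= C * e ->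
  `|a * y1 + b * y2| <= C * (`|a| + `|b|) * e.
Proof.
move=> h1 h2; apply: (le_trans (ler_normD _ _)); rewrite !normrM.
rewrite (_ : C * _ * e = `|a| * (C * e) + `|b| * (C * e)); last by ring.
by rewrite lerD// ler_wpM2l.
Qed.

Lemma pure_mode_bound (a e lam : R) : 0 <= lam -> 0 <= e ->
  `|a * e| <= (1 + lam) * (`|a| + `|- (lam * a)|) * e /\
  `|a * (- lam * e)| <= (1 + lam) * (`|a| + `|- (lam * a)|) * e.
Proof.
move=> l0 e0; rewrite !normrM !normrN !normrM (ger0_norm e0) (ger0_norm l0).
rewrite (_ : `|a| * (lam * e) = lam * `|a| * e); last by ring.
have a0 := normr_ge0 a.
by split; rewrite ler_wpM2r//; nra.
Qed.

(** Parametrised by the two decay exponents, whose product is [kappa] and whose sum is [beta]; this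
    keeps square roots out of the computation. *)
Lemma overdamped_basis (l1 l2 : R) : l1 != l2 ->
  damped_basis (l1 * l2) (l1 + l2)
    (fun t => (l2 * expR (- l1 * t) - l1 * expR (- l2 * t)) / (l2 - l1))
    (fun t => - (l1 * l2) * (expR (- l1 * t) - expR (- l2 * t)) / (l2 - l1))
    (fun t => (expR (- l1 * t) - expR (- l2 * t)) / (l2 - l1))
    (fun t => (l2 * expR (- l2 * t) - l1 * expR (- l1 * t)) / (l2 - l1)).
Proof.
move=> l12; have d0 : l2 - l1 != 0 by rewrite subr_eq0 eq_sym.
split; try by move=> t; derive_tac; rewrite /=; ring.
by rewrite !mulr0 expR0 !mulr1 !subrr mul0r mulfV// mulr0 mul0r.
Qed.

Lemma critical_basis alpha :
  damped_basis (alpha ^+ 2) (2 * alpha)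
    (fun t => (1 + alpha * t) * expR (- alpha * t))
    (fun t => - alpha ^+ 2 * t * expR (- alpha * t))
    (fun t => t * expR (- alpha * t))
    (fun t => (1 - alpha * t) * expR (- alpha * t)).
Proof.
split; try by move=> t; derive_tac; rewrite /=; ring.
by rewrite !mulr0 !mul0r expR0 addr0 subr0 mulr1.
Qed.

Lemma underdamped_basis alpha omega : omega != 0 ->
  damped_basis (alpha ^+ 2 + omega ^+ 2) (2 * alpha)
    (fun t => (cos (omega * t) + alpha / omega * sin (omega * t)) * expR (- alpha * t))
    (fun t => - (alpha ^+ 2 + omega ^+ 2) / omega * sin (omega * t) * expR (- alpha * t))
    (fun t => omega^-1 * sin (omega * t) * expR (- alpha * t))
    (fun t => (cos (omega * t) - alpha / omega * sin (omega * t)) * expR (- alpha * t)).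
Proof.
move=> o0; split; try by move=> t; derive_tac; rewrite /=; field.
by rewrite !mulr0 sin0 cos0 expR0 !mulr0 !mul0r addr0 subr0 mulr1.
Qed.

End Bases.

(** * The damping regimes *)

Section Regimes.
Context {R : realType} {n : nat}.
Variables (rho0 u0 phi0 : R -> R).
Hypothesis hphi0 : nonvacuous phi0.

(** Division by zero yields 0, so the indicator could also vanish through its denominator; the
    uniform gap excludes this. *)
Lemma indicator_eq0 (lam : R) :
  (forall r, 0 < r -> decay_indicator lam u0 phi0 r = 0) ->
  forall r, 0 < r -> 1 * (derive1 u0 r + lam * derive1 (derive1 phi0) r) = 0.
Proof.
move=> h r r0; rewrite mul1r; have /eqP := h r r0; rewrite /decay_indicator.
case: hphi0 => c c0 hc; rewrite mulf_eq0 => /orP[/eqP//|].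
rewrite invr_eq0 subr_eq0 => /eqP e; have := hc r r0.
by rewrite -e lerBrDl gerDr leNgt c0.
Qed.

Lemma overdamped_fast (l1 l2 : R) : 0 < l1 -> l1 < l2 ->
  (forall r, 0 < r -> decay_indicator l2 u0 phi0 r = 0) ->
  decays_at_rate n (l1 * l2) (l1 + l2) rho0 u0 phi0 l2.
Proof.
move=> l10 l12 h; have l20 := lt_trans l10 l12.
have ne : l1 != l2 by rewrite lt_eqF.
have d0 : l2 - l1 != 0 by rewrite subr_eq0 eq_sym.
apply: (@decay_of_modes _ _ _ _ _ _ _ _ _ _ _ l2 1 l2 (1 + l2) (overdamped_basis ne)) => //.
- by rewrite addr_ge0// ltW.
- exact: indicator_eq0.
move=> a b t t0; rewrite mul1r => /eqP; rewrite addr_eq0 => /eqP ->.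
have := pure_mode_bound a (ltW l20) (expR_ge0 (- l2 * t)).
set e1 := expR (- l1 * t); set e2 := expR (- l2 * t).
(* With [b = - (l2 * a)] the slow exponential [e1] cancels from both the mode and its derivative. *)
rewrite (_ : a * ((l2 * e1 - l1 * e2) / (l2 - l1)) + _ = a * e2); last by field.
by rewrite (_ : a * (_ / (l2 - l1)) + _ = a * (- l2 * e2)); last by field.
Qed.

Lemma overdamped_slow (l1 l2 : R) : 0 < l1 -> l1 < l2 ->
  decays_at_rate n (l1 * l2) (l1 + l2) rho0 u0 phi0 l1.
Proof.
move=> l10 l12; have l20 := lt_trans l10 l12.
have ne : l1 != l2 by rewrite lt_eqF.
have d0 : 0 < l2 - l1 by rewrite subr_gt0.
(* The numerator adds up the bounds [l1 + l2], [l1 * l2] and 1 for the numerators of the basis, so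
   one [C] serves all four functions. *)
pose C := (l1 + l2 + l1 * l2 + 1) / (l2 - l1).
have C0 : 0 <= l1 + l2 + l1 * l2 + 1 by rewrite !addr_ge0 ?mulr_ge0 ?ltW.
apply: (@decay_of_modes _ _ _ _ _ _ _ _ _ _ _ l1 0 0 C (overdamped_basis ne)) => //.
- by rewrite divr_ge0 ?(ltW d0).
- by move=> r _; rewrite mul0r.
move=> a b t t0 _; set e1 := expR (- l1 * t); set e2 := expR (- l2 * t).
have e20 : 0 <= e2 by exact: expR_ge0.
have e12 : e2 <= e1 by rewrite ler_expR !mulNr lerN2 ler_wpM2r// ltW.
have bnd x : `|x| <= (l1 + l2 + l1 * l2 + 1) * e1 -> `|x / (l2 - l1)| <= C * e1.
  move=> hx; rewrite normrM normfV (gtr0_norm d0) /C mulrAC ler_wpM2r//.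
  by rewrite invr_ge0 ltW.
have p1 : 0 <= l1 * e2 by rewrite mulr_ge0// ltW.
have p2 : 0 <= l2 * e2 by rewrite mulr_ge0// ltW.
have q1 : 0 <= l1 * (e1 - e2) by rewrite mulr_ge0 ?subr_ge0// ltW.
have q2 : 0 <= l2 * (e1 - e2) by rewrite mulr_ge0 ?subr_ge0// ltW.
have q3 : 0 <= l1 * l2 * (e1 - e2) by rewrite !mulr_ge0 ?subr_ge0// ltW.
have q4 : 0 <= l1 * l2 * e2 by rewrite !mulr_ge0// ltW.
by split; apply: mode_bound; apply: bnd; rewrite ler_norml; apply/andP; split; lra.
Qed.

Lemma critical_fast (alpha : R) : 0 < alpha ->
  (forall r, 0 < r -> decay_indicator alpha u0 phi0 r = 0) ->
  decays_at_rate n (alpha ^+ 2) (2 * alpha) rho0 u0 phi0 alpha.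
Proof.
move=> a0 h.
apply: (@decay_of_modes _ _ _ _ _ _ _ _ _ _ _ alpha 1 alpha (1 + alpha) (critical_basis alpha)) => //.
- by rewrite addr_ge0// ltW.
- exact: indicator_eq0.
move=> a b t t0; rewrite mul1r => /eqP; rewrite addr_eq0 => /eqP ->.
have := pure_mode_bound a (ltW a0) (expR_ge0 (- alpha * t)).
set e := expR (- alpha * t).
rewrite (_ : a * ((1 + alpha * t) * e) + _ = a * e); last by ring.
by rewrite (_ : a * (- alpha ^+ 2 * t * e) + _ = a * (- alpha * e)); last by ring.
Qed.

(** The double root produces a factor [t], absorbed by [eps * t <= exp (eps * t)]: this costs [eps]
    in the rate and [1 / eps] in the constant. *)
Lemma critical_slow (alpha eps : R) : 0 < eps -> eps < alpha ->
  decays_at_rate n (alpha ^+ 2) (2 * alpha) rho0 u0 phi0 (alpha - eps).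
Proof.
move=> e0 ea; have a0 := lt_trans e0 ea.
pose C := 1 + (1 + alpha + alpha ^+ 2) / eps.
have C0 : 0 <= (1 + alpha + alpha ^+ 2) / eps.
  by rewrite divr_ge0 ?addr_ge0 ?sqr_ge0 ?ltW.
apply: (@decay_of_modes _ _ _ _ _ _ _ _ _ _ _ (alpha - eps) 0 0 C (critical_basis alpha)) => //.
- by rewrite subr_gt0.
- by rewrite addr_ge0.
- by move=> r _; rewrite mul0r.
move=> a b t t0 _; set e := expR (- alpha * t); set f := expR (- (alpha - eps) * t).
have ee : 0 <= e by exact: expR_ge0.
have tef : eps * t * e <= f.
  have -> : f = expR (eps * t) * e by rewrite /f /e -expRD; congr expR; ring.
  by rewrite ler_wpM2r// (le_trans _ (expR_ge1Dx _))// lerDr.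
have ef : e <= f by rewrite ler_expR ler_wpM2r// lerN2 gerBl ltW.
have te : t * e <= f / eps by rewrite ler_pdivlMr// mulrC mulrA.
have te0 : 0 <= t * e by rewrite mulr_ge0.
have p1 : 0 <= alpha * (f / eps - t * e) by rewrite mulr_ge0 ?subr_ge0// ltW.
have p2 : 0 <= alpha ^+ 2 * (f / eps - t * e) by rewrite mulr_ge0 ?subr_ge0 ?sqr_ge0.
have p3 : 0 <= alpha * (t * e) by rewrite mulr_ge0// ltW.
have p4 : 0 <= alpha ^+ 2 * (t * e) by rewrite mulr_ge0 ?sqr_ge0.
have CE : C * f = f + f / eps + alpha * (f / eps) + alpha ^+ 2 * (f / eps).
  by rewrite /C; ring.
by split; apply: mode_bound; rewrite CE ler_norml; apply/andP; split; lra.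
Qed.

Lemma underdamped (alpha omega : R) : 0 < alpha -> 0 < omega ->
  decays_at_rate n (alpha ^+ 2 + omega ^+ 2) (2 * alpha) rho0 u0 phi0 alpha.
Proof.
move=> a0 o0; have on : omega != 0 by rewrite gt_eqF.
(* One summand for each size of coefficient in front of a sine or cosine of the basis. *)
pose C := 1 + omega^-1 + alpha / omega + (alpha ^+ 2 + omega ^+ 2) / omega.
have o1 : 0 <= omega^-1 by rewrite invr_ge0 ltW.
have o2 : 0 <= alpha / omega by rewrite mulr_ge0// ltW.
have o3 : 0 <= (alpha ^+ 2 + omega ^+ 2) / omega by rewrite mulr_ge0 ?addr_ge0 ?sqr_ge0.
apply: (@decay_of_modes _ _ _ _ _ _ _ _ _ _ _ alpha 0 0 C (underdamped_basis alpha on)) => //.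
- by rewrite !addr_ge0.
- by move=> r _; rewrite mul0r.
move=> a b t t0 _; set e := expR (- alpha * t).
have ee : 0 <= e by exact: expR_ge0.
have bnd x : `|x| <= C -> `|x * e| <= C * e.
  by move=> hx; rewrite normrM (ger0_norm ee) ler_wpM2r.
have hs k : 0 <= k -> `|k * sin (omega * t)| <= k.
  by move=> k0; rewrite normrM (ger0_norm k0) ler_piMr// ler_norml sin_geN1 sin_le1.
have hc : `|cos (omega * t)| <= 1 by rewrite ler_norml cos_geN1 cos_le1.
have h1 := hs _ o1; have h2 := hs _ o2; have h3 := hs _ o3.
split; apply: mode_bound; apply: bnd.
- by apply: (le_trans (ler_normD _ _)); rewrite /C; lra.
- by apply: (le_trans h1); rewrite /C; lra.
- by rewrite !mulNr normrN; apply: (le_trans h3); rewrite /C; lra.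
- by apply: (le_trans (ler_normB _ _)); rewrite /C; lra.
Qed.

End Regimes.

Unset Implicit Arguments.

Theorem theorem4p3 (R : realType) (n : nat) (kappa beta eps : R)
  (rho0 u0 phi0 : R -> R)
  (hkappa : 0 < kappa) (hbeta : 0 < beta) (heps : 0 < eps)
  (hphi0 : nonvacuous phi0) :
  [/\ (* strong damping *)
      2 * Num.sqrt kappa < beta ->
      let lambda1 := (beta - Num.sqrt (beta ^+ 2 - 4 * kappa)) / 2 in
      let lambda2 := (beta + Num.sqrt (beta ^+ 2 - 4 * kappa)) / 2 in
      ((forall r, 0 < r -> decay_indicator lambda2 u0 phi0 r = 0) ->
        decays_at_rate n kappa beta rho0 u0 phi0 lambda2) /\
      ((exists2 r, 0 < r & decay_indicator lambda2 u0 phi0 r <> 0) ->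
        decays_at_rate n kappa beta rho0 u0 phi0 lambda1),
      (* critical damping *)
      beta = 2 * Num.sqrt kappa ->
      let alpha := beta / 2 in
      ((forall r, 0 < r -> decay_indicator alpha u0 phi0 r = 0) ->
        decays_at_rate n kappa beta rho0 u0 phi0 (beta / 2)) /\
      ((exists2 r, 0 < r & decay_indicator alpha u0 phi0 r <> 0) ->
        decays_at_rate n kappa beta rho0 u0 phi0 (beta / 2 - eps))
    & (* weak damping *)
      beta < 2 * Num.sqrt kappa ->
      decays_at_rate n kappa beta rho0 u0 phi0 (beta / 2)].
Proof.
have sk : 0 < Num.sqrt kappa by rewrite sqrtr_gt0.
have sk2 : Num.sqrt kappa ^+ 2 = kappa by rewrite sqr_sqrtr// ltW.
split.
- move=> hb l1 l2; pose d := Num.sqrt (beta ^+ 2 - 4 * kappa).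
  have l1E : l1 = (beta - d) / 2 by [].
  have l2E : l2 = (beta + d) / 2 by [].
  have disc : 0 < beta ^+ 2 - 4 * kappa.
    have : (2 * Num.sqrt kappa) ^+ 2 < beta ^+ 2 by rewrite ltr_sqr ?nnegrE ?ltW// mulr_gt0.
    by rewrite exprMn sk2 subr_gt0; apply: le_lt_trans; rewrite -natrX.
  have d0 : 0 < d by rewrite sqrtr_gt0.
  have d2 : d ^+ 2 = beta ^+ 2 - 4 * kappa by rewrite sqr_sqrtr// ltW.
  have db : d < beta.
    by rewrite -ltr_sqr ?nnegrE ?ltW// d2; lra.
  have l10 : 0 < l1 by rewrite l1E divr_gt0// subr_gt0.
  have l12 : l1 < l2 by rewrite l1E l2E; lra.
  have lk : kappa = l1 * l2.
    rewrite (_ : l1 * l2 = (beta ^+ 2 - d ^+ 2) / 4); last by rewrite l1E l2E; field.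
    by rewrite d2; field.
  have lb : beta = l1 + l2 by rewrite l1E l2E; field.
  clearbody l1 l2; rewrite {}lk {}lb in l1E l2E *; split=> [h|_].
    exact: overdamped_fast.
  exact: overdamped_slow.
- move=> hb alpha.
  have ak : kappa = alpha ^+ 2 by rewrite -sk2 /alpha hb; field.
  have ab : beta = 2 * alpha by rewrite /alpha; field.
  have a0 : 0 < alpha by rewrite divr_gt0.
  rewrite -/alpha; clearbody alpha; rewrite ak ab; split=> [h|_].
    exact: critical_fast.
  (* A large [eps] would make the rate nonpositive, where the estimate of modes does not apply; it
     is replaced by one below [alpha], which gives a faster decay. *)
  apply: (@decays_at_rate_le _ _ _ _ _ _ _ _ (alpha - Num.min eps (alpha / 2))).
    by rewrite lerB// ge_min lexx.
  apply: critical_slow => //; first by rewrite lt_min heps divr_gt0.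
  by rewrite gt_min; apply/orP; right; lra.
(* The characteristic roots are [- alpha + i omega] and [- alpha - i omega]. *)
- move=> hb; pose alpha := beta / 2; pose omega := Num.sqrt (kappa - alpha ^+ 2).
  have o2 : 0 < kappa - alpha ^+ 2.
    rewrite subr_gt0 -sk2 ltr_sqr ?nnegrE ?divr_ge0 ?(ltW sk) ?(ltW hbeta)//.
    by rewrite /alpha; lra.
  have ak : kappa = alpha ^+ 2 + omega ^+ 2 by rewrite /omega sqr_sqrtr ?(ltW o2)//; ring.
  have ab : beta = 2 * alpha by rewrite /alpha; field.
  have a0 : 0 < alpha by rewrite divr_gt0.
  have o0 : 0 < omega by rewrite sqrtr_gt0.
  by rewrite -/alpha; clearbody alpha omega; rewrite ak ab; exact: underdamped.
Qed.
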